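(* Let $G$ be a totally disconnected locally compact group, $R$ a commutative ring with the discrete topology, $n\in\mathbb{N}\cup\{\infty\}$, and let $0\to A'\xrightarrow{f}A\xrightarrow{g}A''\to 0$ be a short exact sequence of $k$-$R[G]$-modules. Then the following hold over $R$: (a) if $A'$ has type $\mathrm{KP}_{n-1}$ and $A$ has type $\mathrm{KP}_n$, then $A''$ has type $\mathrm{KP}_n$; (b) if $A$ has type $\mathrm{KP}_{n-1}$ and $A''$ has type $\mathrm{KP}_n$, then $A'$ has type $\mathrm{KP}_{n-1}$; (c) if $A'$ and $A''$ have type $\mathrm{KP}_n$, then so does $A$.
   Context: A $k$-space is a compactly generated weakly Hausdorff space; products are taken in the category of $k$-spaces. The group ring $R[G]$ carries a topology making it a $k$-$R$-algebra such that every continuous homomorphism from $G$ to the unit group of a $k$-$R$-algebra $S$ factors uniquely through $R[G]\to S$. A $k$-$R[G]$-module is a module object over $R[G]$ in $k$-spaces (a $k$-space that is an $R$-module with continuous operations and a continuous $R$-linear action of $G$); morphisms are continuous module homomorphisms. For a $k$-space $Y$, the free $k$-$R[G]$-module $R[G\times Y]$ on $Y$ is the value at $Y$ of the left adjoint of the forgetful functor to $k$-spaces. The compact Hausdorff structure: the projective objects are the direct summands of free $k$-$R[G]$-modules on disjoint unions of compact Hausdorff spaces; a morphism $A\to B$ is called CH-split if every morphism from a projective object to $B$ lifts to $A$. A short exact sequence $0\to A'\xrightarrow{f}A\xrightarrow{g}A''\to0$ is one in this exact structure: $f$ is a kernel of $g$, and $g$ is CH-split. A projective resolution of $A$ is an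 exact chain complex $\cdots\to P_1\xrightarrow{d_1}P_0\xrightarrow{d_0}A\to0$ with all $P_i$ projective such that each map $P_i\to\ker(d_{i-1})$ is CH-split (for $i=0$: $P_0\to A$ is CH-split). A $k$-$R[G]$-module is compactly generated if there is a CH-split map onto it from a free module on a compact Hausdorff space. $A$ has type $\mathrm{KP}_n$ over $R$ ($n\le\infty$) if it has a projective resolution $P\to A$ with $P_i$ compactly generated for all $i\le n$. Type $\mathrm{KP}_{-1}$ is no condition, and $\infty-1=\infty$. *)

(* Defs.v *)
From HB Require Import structures.
From mathcomp Require Import all_boot all_order all_algebra.
From mathcomp Require Import all_classical.
From mathcomp Require Import topology.

Set Implicit Arguments.
Unset Strict Implicit.
Unset Printing Implicit Defensive.

Import GRing.Theory.
Local Open Scope classical_set_scope.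
Local Open Scope ring_scope.

Definition compact_hausdorff (K : topologicalType) : Prop :=
  compact [set: K] /\ hausdorff_space K.

Definition k_open (T : topologicalType) : set_system T :=
  [set U | forall (K : topologicalType) (u : K -> T),
      compact_hausdorff K -> continuous u -> open (u @^-1` U)].

Definition weakly_hausdorff (T : topologicalType) : Prop :=
  forall (K : topologicalType) (u : K -> T),
    compact_hausdorff K -> continuous u -> closed (range u).

Definition k_space (T : topologicalType) : Prop :=
  (forall U : set T, k_open U -> open U) /\ weakly_hausdorff T.

Definition kification (T : Type) : Type := T.

HB.instance Definition _ (T : choiceType) := Choice.on (kification T).

Section KificationTopology.
Variable T : topologicalType.

Lemma k_openT : @k_open T setT.
Proof. by move=> K u _ _; rewrite preimage_setT; exact: openT. Qed.

Lemma k_openI : setI_closed (@k_open T).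
Proof.
by move=> U V kU kV K u hK cu; rewrite preimage_setI; apply: openI;
  [exact: kU | exact: kV].
Qed.

Lemma k_open_bigU (I : Type) (U : I -> set T) :
  (forall i, k_open (U i)) -> k_open (\bigcup_i U i).
Proof.
move=> kU K u hK cu; rewrite preimage_bigcup; apply: bigcup_open => i _.
exact: kU.
Qed.

HB.instance Definition _ := isOpenTopological.Build (kification T)
  k_openT k_openI k_open_bigU.

End KificationTopology.

(* The product in the category of k-spaces: the k-ification of the product
   topology. *)
Definition kprod (X Y : topologicalType) : topologicalType :=
  kification (X * Y)%type.

#[short(type="preTopGroupType")]
HB.structure Definition PreTopologicalGroup := {G of Group G & Topological G}.

HB.mixin Record PreTopologicalGroup_isTopologicalGroup G
    of PreTopologicalGroup G := {
  mulg_continuous : continuous (fun xy : G * G => (xy.1 * xy.2)%g);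
  invg_continuous : continuous (fun x : G => x^-1%g)
}.

#[short(type="topGroupType")]
HB.structure Definition TopologicalGroup :=
  {G of PreTopologicalGroup_isTopologicalGroup G & PreTopologicalGroup G}.

HB.mixin Record isKModule (R : comPzRingType) (G : topGroupType) M
    of Topological M & GRing.Lmodule R M := {
  kmod_k_space : k_space M;
  kmod_add_continuous : continuous (fun xy : kprod M M => xy.1 + xy.2 : M);
  kmod_scale_continuous : continuous
    (fun rx : kprod (discrete_topology R) M => (rx.1 : R) *: rx.2 : M);
  gact : G -> M -> M;
  gact1 : forall x, gact 1%g x = x;
  gactM : forall g h x, gact (g * h)%g x = gact g (gact h x);
  gact_linear : forall g, linear (gact g);
  gact_continuous : continuous (fun gx : kprod G M => gact gx.1 gx.2 : M)
}.

(* The k-R[G]-modules. *)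
#[short(type="kModType")]
HB.structure Definition KModule (R : comPzRingType) (G : topGroupType) :=
  {M of isKModule R G M & Topological M & GRing.Lmodule R M}.

Section KModuleTheory.
Variables (R : comPzRingType) (G : topGroupType).
Local Notation kMod := (kModType R G).

Definition kmorphism (A B : kMod) (f : A -> B) : Prop :=
  [/\ linear f, continuous f & forall (g : G) x, f (gact g x) = gact g (f x)].

(* F, together with eta, is the free module R[G x Y]: the value at Y of the
   left adjoint of the forgetful functor is determined, up to a unique
   isomorphism compatible with eta, by this universal arrow. *)
Definition is_free_on (Y : topologicalType) (F : kMod) (eta : Y -> F) : Prop :=
  continuous eta /\
  forall (M : kMod) (phi : Y -> M), continuous phi ->
    exists! psi : F -> M, kmorphism psi /\ psi \o eta = phi.

Definition direct_summand (P F : kMod) : Prop :=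
  exists (Q : kMod) (iP : P -> F) (pP : F -> P) (iQ : Q -> F) (pQ : F -> Q),
    [/\ kmorphism iP, kmorphism pP, kmorphism iQ & kmorphism pQ] /\
    [/\ pP \o iP = id, pQ \o iQ = id &
        forall x : F, iP (pP x) + iQ (pQ x) = x].

Definition projective (P : kMod) : Prop :=
  exists (I : choiceType) (X : I -> topologicalType) (F : kMod)
      (eta : {i & X i} -> F),
    [/\ forall i, compact_hausdorff (X i), is_free_on eta
      & direct_summand P F].

Definition ch_split (A B : kMod) (g : A -> B) : Prop :=
  kmorphism g /\
  forall (P : kMod) (h : P -> B), projective P -> kmorphism h ->
    exists h' : P -> A, kmorphism h' /\ g \o h' = h.

Definition is_kernel (K A B : kMod) (k : K -> A) (g : A -> B) : Prop :=
  [/\ kmorphism k, forall x, g (k x) = 0 &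
      forall (C : kMod) (h : C -> A), kmorphism h -> (forall x, g (h x) = 0) ->
        exists! h' : C -> K, kmorphism h' /\ k \o h' = h].

Definition short_exact (A' A A'' : kMod) (f : A' -> A) (g : A -> A'') : Prop :=
  is_kernel f g /\ ch_split g.

Definition exact_at (A B C : kMod) (f : A -> B) (g : B -> C) : Prop :=
  forall y, g y = 0 <-> exists x, f x = y.

Definition ch_split_onto_kernel (A B C : kMod) (f : A -> B) (g : B -> C) :
    Prop :=
  exists (K : kMod) (k : K -> B) (e : A -> K),
    [/\ is_kernel k g, ch_split e & k \o e = f].

(* d i is the differential P_{i+1} -> P_i, and eps is the augmentation
   d_0 : P_0 -> A. *)
Definition projective_resolution (A : kMod) (P : nat -> kMod)
    (d : forall i, P i.+1 -> P i) (eps : P 0%N -> A) : Prop :=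
  [/\ (forall i, projective (P i)),
      (forall i, kmorphism (d i)) /\ kmorphism eps,
      [/\ (forall y, exists x, eps x = y), exact_at (d 0%N) eps
        & forall i, exact_at (d i.+1) (d i)]
    & [/\ ch_split eps, ch_split_onto_kernel (d 0%N) eps
        & forall i, ch_split_onto_kernel (d i.+1) (d i)]].

Definition compactly_generated (A : kMod) : Prop :=
  exists (K : topologicalType) (F : kMod) (eta : K -> F) (e : F -> A),
    [/\ compact_hausdorff K, is_free_on eta, ch_split e
      & forall y, exists x, e x = y].

(* N extended with infinity: None stands for infinity. *)
Definition le_ext (i : nat) (n : option nat) : Prop :=
  if n is Some m then (i <= m)%N else True.

Definition type_KP (n : option nat) (A : kMod) : Prop :=
  exists (P : nat -> kMod) (d : forall i, P i.+1 -> P i) (eps : P 0%N -> A),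
    projective_resolution d eps /\
    forall i, le_ext i n -> compactly_generated (P i).

(* Type KP_{n-1}; KP_{-1} is no condition, and infinity - 1 = infinity. *)
Definition type_KP_pred (n : option nat) (A : kMod) : Prop :=
  match n with
  | Some 0%N => True
  | Some m.+1 => type_KP (Some m) A
  | None => type_KP None A
  end.

End KModuleTheory.

(* Main.v *)
Require Import Defs.
From HB Require Import structures.
From mathcomp Require Import all_boot all_order all_algebra.
From mathcomp Require Import generic_quotient.
From mathcomp Require Import all_classical.
From mathcomp Require Import topology.

(** Everything about k-modules that the theorem involves can be tested on maps
    from compact Hausdorff spaces, called plots below.  Morphisms from a projective module amount to
    families of such maps, so a morphism is CH-split exactly when maps from
    compact Hausdorff spaces lift along it (ch_splitP); and since the spaces are
    compactly generated, a morphism is a kernel exactly when it is an injection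
    onto the algebraic kernel that reflects continuity of such maps
    (is_kernelP).  Short exact sequences can therefore be handled pointwise.

    Say that a module is resolved n steps if it is the end of an exact sequence
    of n CH-split covers by free modules on compact Hausdorff spaces
    (cg_resolved).  For a short exact sequence, the horseshoe construction shows
    by induction that the middle term is resolved as many steps as the outer ones
    (cg_resolved_extension).  The other two statements follow by recognizing new
    extensions: covering the quotient by a cover of the middle term
    (cg_resolved_quotient), and pulling the sequence back along a cover of the
    quotient, where it splits (cg_resolved_kernel).

    It remains to identify type KP_n with being resolved n + 1 steps.  A
    compactly generated projective is a retract of a free module on a compact
    Hausdorff space, and such retracts are resolved any number of steps, which
    gives one direction.  For the other, a resolution must be continued past
    degree n, so every module needs some projective cover: the free module on the
    disjoint union of its compact Hausdorff subspaces, or on a single one of them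
    if the module is compactly generated.  Replacing a given cover by this one
    is harmless by the Schanuel argument in cg_resolved_kernel, so iterating the
    construction gives one resolution that works for all finite n at once, hence
    also for infinite type (type_KPP).

    Kernels, direct sums and free modules are all obtained from one construction:
    a set with operations and a jointly injective family of coordinates in
    k-modules inherits the structure of a k-module (submodule).  For free modules
    the coordinates are the evaluations of formal expressions in all k-modules. *)

Set Implicit Arguments.
Unset Strict Implicit.
Unset Printing Implicit Defensive.

Import GRing.Theory.
Local Open Scope classical_set_scope.
Local Open Scope ring_scope.
Local Open Scope quotient_scope.

(** * Compactly generated spaces and compact Hausdorff tests *)

Lemma compact_set_type (X : topologicalType) (A : set X) :
  compact A -> compact [set: A].
Proof.
move=> cA F PF _.
have [p [Ap clp]] : A `&` cluster (set_val @ F) !=set0.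
  apply: cA; apply: (@filterS _ F _ setT); last exact: filterT.
  by move=> x _; exact: set_valP.
exists (exist _ p (mem_set Ap)); split=> // B U FB nU.
move: nU; rewrite nbhsE => -[V [[W oW WV] Vp] VU].
have [||y [[x Bx xy] Wy]] := clp (set_val @` B) W.
- by apply: (@filterS _ F _ B) => // x Bx; exists x.
- by apply: open_nbhs_nbhs; split=> //; move: Vp; rewrite -WV.
by exists x; split=> //; apply: VU; rewrite -WV /= xy.
Qed.

Lemma injective_hausdorff (X Y : topologicalType) (f : X -> Y) :
  injective f -> continuous f -> hausdorff_space Y -> hausdorff_space X.
Proof.
move=> injf cf hY x y clxy; apply: injf; apply: hY => A B nA nB.
have [z [Az Bz]] := clxy _ _ (cf _ _ nA) (cf _ _ nB).
by exists (f z).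
Qed.

Lemma compact_hausdorff_closed (K : topologicalType) (A : set K) :
  compact_hausdorff K -> closed A -> compact_hausdorff A.
Proof.
move=> [cK hK] clA; split.
  exact/compact_set_type/(subclosed_compact clA cK).
apply: (injective_hausdorff _ (@initial_continuous _ _ set_val)) hK.
exact: val_inj.
Qed.

Definition one_point : topologicalType := discrete_topology unit.

Lemma compact_hausdorff_one_point : compact_hausdorff one_point.
Proof.
split; last by move=> [] [].
apply: finite_compact; apply: (@sub_finite_set _ _ [set tt]) => //.
by case.
Qed.

(** A weakly Hausdorff space need not be Hausdorff, but the image of a compact
    Hausdorff space in it is: the fibres of two points are disjoint closed
    sets, normality of [K] separates them, and the map is closed because closed
    subsets of [K] are again compact Hausdorff.  The two open sets are stated
    in [X], and are disjoint only along the image. *)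
Lemma separate_points_compact_hausdorff (X K : topologicalType) (u : K -> X)
    x y :
  weakly_hausdorff X -> compact_hausdorff K -> continuous u -> x != y ->
  exists UV : set X * set X, [/\ open UV.1, open UV.2, UV.1 x, UV.2 y &
    forall k, UV.1 (u k) -> UV.2 (u k) -> False].
Proof.
move=> wX hK cu xy.
have point_closed (z : X) : closed [set z].
  suff <- : range (fun _ : one_point => z) = [set z].
    exact: wX compact_hausdorff_one_point (fun=> cvg_cst _).
  by apply/seteqP; split=> [_ [? _ <-]|_ ->] //; exists tt.
have image_closed (A : set K) : closed A -> closed (u @` A).
  move=> clA; suff <- : range (u \o set_val : A -> X) = u @` A.
    apply: wX; first exact: compact_hausdorff_closed.
    move=> a; apply: continuous_comp; first exact: initial_continuous.
    exact: cu.
  apply/seteqP; split=> [_ [a _ <-]|_ [a Aa <-]].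
    by exists (set_val a) => //; exact: set_valP.
  by exists (exist _ a (mem_set Aa)).
have closed_fiber (z : X) : closed (u @^-1` [set z]).
  by apply: closed_comp => // k _; exact: cu.
have nK : normal_space K by apply: compact_normal; case: hK.
have [B [nB BU]] : exists B, set_nbhs (u @^-1` [set x]) B /\
    closure B `<=` ~` (u @^-1` [set y]).
  have [|B sB BU] := nK _ (closed_fiber x) (~` (u @^-1` [set y])).
    move=> k kx; apply: open_nbhs_nbhs; split; first exact: closed_openC.
    by move=> ky; move/eqP: xy; apply; rewrite -kx.
  by exists B.
exists (~` (u @` (~` B°)), ~` (u @` closure B)) => /=; split.
- exact/closed_openC/image_closed/open_closedC/open_interior.
- exact/closed_openC/image_closed/closed_closure.
- by move=> [k nCk ukx]; apply: nCk; exact: nB.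
- by move=> [k Bk uky]; apply: (BU k).
- move=> k nk1 nk2; apply: nk1; exists k => // Bk; apply: nk2; exists k => //.
  by apply: subset_closure; exact: interior_subset.
Qed.

Definition sum_space (K L : topologicalType) (b : bool) : topologicalType :=
  if b then K else L.

Definition sum_inl (K L : topologicalType) (k : K) : {b & sum_space K L b} :=
  existT (fun b => sum_space K L b : Type) true k.

Definition sum_inr (K L : topologicalType) (l : L) : {b & sum_space K L b} :=
  existT (fun b => sum_space K L b : Type) false l.

Lemma sum_inl_continuous (K L : topologicalType) : continuous (@sum_inl K L).
Proof. exact: (@existT_continuous bool (sum_space K L) true). Qed.

Lemma sum_inr_continuous (K L : topologicalType) : continuous (@sum_inr K L).
Proof. exact: (@existT_continuous bool (sum_space K L) false). Qed.

Definition sum_map (K L : topologicalType) (X : Type) (u : K -> X)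
    (v : L -> X) : {b & sum_space K L b} -> X :=
  fun z => match z with
    | existT true k => u k
    | existT false l => v l
    end.

Lemma compact_hausdorff_sigT (I : choiceType) (X : I -> topologicalType) :
  finite_set [set: I] -> (forall i, compact_hausdorff (X i)) ->
  compact_hausdorff {i & X i}.
Proof.
move=> finI hX; split; first by apply: sigT_compact => // i; case: (hX i).
by apply: sigT_hausdorff => i; case: (hX i).
Qed.

Lemma compact_hausdorff_sum (K L : topologicalType) :
  compact_hausdorff K -> compact_hausdorff L ->
  compact_hausdorff {b & sum_space K L b}.
Proof.
move=> hK hL; apply: compact_hausdorff_sigT => [|[]//].
exact: finite_finset.
Qed.

Lemma sum_map_continuous (K L X : topologicalType) (u : K -> X) (v : L -> X) :
  continuous u -> continuous v -> continuous (sum_map u v).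
Proof. by move=> cu cv [[] x] U nU; [exact: cu nU | exact: cv nU]. Qed.

(** Weak Hausdorffness behaves like a closed diagonal as long as it is tested by
    compact Hausdorff spaces; gluing [K] and [L] into one space puts both images
    into a single compact Hausdorff subspace. *)
Lemma weakly_hausdorff_equalizer_closed (X K L : topologicalType)
    (u : K -> X) (v : L -> X) :
  weakly_hausdorff X -> compact_hausdorff K -> compact_hausdorff L ->
  continuous u -> continuous v ->
  closed [set kl : K * L | u kl.1 = v kl.2].
Proof.
move=> wX hK hL cu cv; rewrite -openC openE => -[k l] /= /eqP ukl.
have [[U V] [/= oU oV Uk Vl UV]] :=
  separate_points_compact_hausdorff wX (compact_hausdorff_sum hK hL)
    (sum_map_continuous cu cv) ukl.
exists (u @^-1` U, v @^-1` V) => /=.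
  by split; [apply: cu | apply: cv]; exact: open_nbhs_nbhs.
move=> [k' l'] /= [Uk' Vl'] /= uvkl'.
by apply: (UV (existT _ true k')) => //; rewrite [sum_map _ _ _]uvkl'.
Qed.

(** The preimage is the projection to [L] of the equalizer, and a projection
    along a compact factor is closed. *)
Lemma preimage_range_closed (T : Type) (K L : topologicalType)
    (u : K -> T) (v : L -> T) :
  compact_hausdorff K -> compact_hausdorff L ->
  closed [set kl : K * L | u kl.1 = v kl.2] ->
  closed (v @^-1` range u).
Proof.
move=> [cK hK] [cL hL] clE.
suff <- : snd @` [set kl : K * L | u kl.1 = v kl.2] = v @^-1` range u.
  apply: compact_closed => //; apply: continuous_compact.
    by apply: continuous_subspaceT => -[k l]; exact: cvg_snd.
  apply: (subclosed_compact clE (compact_setX cK cL)) => //.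
apply/seteqP; split=> [_ [[k l] /= kl <-]|l [k _ kl]]; first by exists k.
by exists (k, l).
Qed.

Definition k_generated (T : topologicalType) :=
  forall U : set T, k_open U -> open U.

Lemma k_generated_continuous (T Y : topologicalType) (h : T -> Y) :
  k_generated T ->
  (forall (K : topologicalType) (u : K -> T), compact_hausdorff K ->
    continuous u -> continuous (h \o u)) ->
  continuous h.
Proof.
move=> gT hu; apply/continuousP => V oV; apply: gT => K u hK cu.
by rewrite -comp_preimage; move: V oV; apply/continuousP/hu.
Qed.

Lemma compact_hausdorff_k_generated (K : topologicalType) :
  compact_hausdorff K -> k_generated K.
Proof. by move=> hK U /(_ K id hK); apply=> x; exact: cvg_id. Qed.

Lemma sigT_k_generated (I : choiceType) (X : I -> topologicalType) :
  (forall i, compact_hausdorff (X i)) -> k_generated {i & X i}.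
Proof.
move=> hX U kU; apply/sigT_openP => i; apply: kU (hX i) _.
exact: existT_continuous.
Qed.

(** Compact Hausdorff spaces do not see the difference between the product
    topology and its k-ification, so neither does a compactly generated
    source. *)
Lemma to_kprod_continuous (K X Y : topologicalType) (u : K -> X * Y) :
  k_generated K -> continuous u -> continuous (u : K -> kprod X Y).
Proof.
move=> gK cu; apply/continuousP => V oV; apply: gK => L v hL cv.
rewrite -comp_preimage; apply: oV => // l.
by apply: continuous_comp; [exact: cv | exact: cu].
Qed.

Lemma from_kprod_continuous (X Y : topologicalType) :
  continuous (id : kprod X Y -> X * Y).
Proof.
apply/continuousP => V oV; change (k_open V) => K u hK cu.
by move: V oV; apply/continuousP.
Qed.

Lemma kprod_k_generated (X Y : topologicalType) : k_generated (kprod X Y).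
Proof.
move=> U kU; change (@k_open (X * Y)%type U) => K u hK cu; apply: kU => //.
exact: to_kprod_continuous (compact_hausdorff_k_generated hK) cu.
Qed.

Lemma kprod_pair_continuous (K X Y : topologicalType) (a : K -> X)
    (b : K -> Y) :
  k_generated K -> continuous a -> continuous b ->
  continuous (fun k => (a k, b k) : kprod X Y).
Proof.
move=> gK ca cb; apply: to_kprod_continuous => // k.
by apply: cvg_pair; [exact: ca | exact: cb].
Qed.

Lemma kprod_fst_continuous (X Y : topologicalType) :
  continuous (fst : kprod X Y -> X).
Proof.
move=> z; apply: (continuous_comp (@from_kprod_continuous X Y z)).
exact: cvg_fst.
Qed.

Lemma kprod_snd_continuous (X Y : topologicalType) :
  continuous (snd : kprod X Y -> Y).
Proof.
move=> z; apply: (continuous_comp (@from_kprod_continuous X Y z)).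
exact: cvg_snd.
Qed.

Lemma kprod_map_continuous (X Y X' Y' : topologicalType)
    (a : X -> X') (b : Y -> Y') :
  continuous a -> continuous b ->
  continuous (fun z : kprod X Y => (a z.1, b z.2) : kprod X' Y').
Proof.
move=> ca cb; apply: kprod_pair_continuous; first exact: kprod_k_generated.
  by move=> z; apply: continuous_comp (ca _); exact: kprod_fst_continuous.
by move=> z; apply: continuous_comp (cb _); exact: kprod_snd_continuous.
Qed.

(** * Modules embedded in products of k-modules *)

(** Algebraic data on a set together with a jointly injective family of
    coordinates in k-modules which respect them: a submodule, in the abstract
    sense, of a product of k-modules.  The family is a predicate on maps to all
    k-modules, so it may be as large as the class of k-modules itself; this is
    what makes the construction of free modules possible. *)
Record preSubmodule (R : comPzRingType) (G : topGroupType) := PreSubmodule {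
  presub_sort : choiceType;
  presub_zero : presub_sort;
  presub_opp : presub_sort -> presub_sort;
  presub_add : presub_sort -> presub_sort -> presub_sort;
  presub_scale : R -> presub_sort -> presub_sort;
  presub_act : G -> presub_sort -> presub_sort;
  presub_coord : forall M : kModType R G, (presub_sort -> M) -> Prop;
  presub_coord_morph : forall (M : kModType R G) (f : presub_sort -> M),
    presub_coord f ->
    [/\ f presub_zero = 0, {morph f : x / presub_opp x >-> - x},
        {morph f : x y / presub_add x y >-> x + y},
        forall r, {morph f : x / presub_scale r x >-> r *: x} &
        forall g, {morph f : x / presub_act g x >-> gact g x}];
  presub_sep : forall x y,
    (forall (M : kModType R G) (f : presub_sort -> M),
       presub_coord f -> f x = f y) -> x = y }.

Arguments presub_coord {R G} p {M} f.

Definition submodule (R : comPzRingType) (G : topGroupType)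
  (D : preSubmodule R G) : Type := presub_sort D.

Section Submodule.
Variables (R : comPzRingType) (G : topGroupType) (D : preSubmodule R G).
Local Notation S := (submodule D).
Local Notation kMod := (kModType R G).

HB.instance Definition _ := Choice.on S.

(** The module laws hold because they hold after every coordinate. *)
Lemma submodule_addA : associative (@presub_add R G D).
Proof.
move=> x y z; apply: presub_sep => M f /presub_coord_morph[_ _ fD _ _].
by rewrite !fD addrA.
Qed.

Lemma submodule_addC : commutative (@presub_add R G D).
Proof.
move=> x y; apply: presub_sep => M f /presub_coord_morph[_ _ fD _ _].
by rewrite !fD addrC.
Qed.

Lemma submodule_add0 : left_id (presub_zero D) (@presub_add R G D).
Proof.
move=> x; apply: presub_sep => M f /presub_coord_morph[f0 _ fD _ _].
by rewrite fD f0 add0r.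
Qed.

Lemma submodule_addN :
  left_inverse (presub_zero D) (@presub_opp R G D) (@presub_add R G D).
Proof.
move=> x; apply: presub_sep => M f /presub_coord_morph[f0 fN fD _ _].
by rewrite fD fN f0 addNr.
Qed.

HB.instance Definition _ := GRing.isZmodule.Build S
  submodule_addA submodule_addC submodule_add0 submodule_addN.

Lemma submodule_scaleA r s (x : S) :
  presub_scale r (presub_scale s x) = presub_scale (r * s) x.
Proof.
apply: presub_sep => M f /presub_coord_morph[_ _ _ fZ _].
by rewrite !fZ scalerA.
Qed.

Lemma submodule_scale1 : left_id 1 (@presub_scale R G D).
Proof.
move=> x; apply: presub_sep => M f /presub_coord_morph[_ _ _ fZ _].
by rewrite fZ scale1r.
Qed.

Lemma submodule_scaleDr :
  right_distributive (@presub_scale R G D) (@presub_add R G D).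
Proof.
move=> r x y; apply: presub_sep => M f /presub_coord_morph[_ _ fD fZ _].
by rewrite fZ !fD !fZ scalerDr.
Qed.

Lemma submodule_scaleDl (x : S) r s :
  presub_scale (r + s) x = presub_add (presub_scale r x) (presub_scale s x).
Proof. apply: presub_sep => M f /presub_coord_morph[_ _ fD fZ _].
by rewrite fD !fZ scalerDl.
Qed.

HB.instance Definition _ := GRing.Zmodule_isLmodule.Build R S
  submodule_scaleA submodule_scale1 submodule_scaleDr submodule_scaleDl.

(** The maps from compact Hausdorff spaces that the topology is to make
    continuous. *)
Definition submodule_plot (K : topologicalType) (u : K -> S) :=
  forall (M : kMod) (f : S -> M), presub_coord D f -> continuous (f \o u).

(** The k-ification of the initial topology of the coordinates, obtained in one
    step as the final topology of the maps from compact Hausdorff spaces which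
    are continuous in every coordinate. *)
Definition submodule_open : set_system S := [set U |
  forall (K : topologicalType) (u : K -> S),
    compact_hausdorff K -> submodule_plot u -> open (u @^-1` U)].

Lemma submodule_openT : submodule_open setT.
Proof. by move=> K u _ _; rewrite preimage_setT; exact: openT. Qed.

Lemma submodule_openI : setI_closed submodule_open.
Proof.
move=> U V oU oV K u hK pu; rewrite preimage_setI.
by apply: openI; [exact: oU | exact: oV].
Qed.

Lemma submodule_open_bigU (I : Type) (U : I -> set S) :
  (forall i, submodule_open (U i)) -> submodule_open (\bigcup_i U i).
Proof.
move=> oU K u hK pu; rewrite preimage_bigcup; apply: bigcup_open => i _.
exact: oU.
Qed.

HB.instance Definition _ := isOpenTopological.Build S
  submodule_openT submodule_openI submodule_open_bigU.

Lemma submodule_coord_continuous (M : kMod) (f : S -> M) :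
  presub_coord D f -> continuous f.
Proof.
move=> Df; apply/continuousP => V oV; change (submodule_open (f @^-1` V)).
move=> K u hK pu; rewrite -comp_preimage.
by move: V oV; apply/continuousP/pu.
Qed.

Lemma submodule_plot_continuous (K : topologicalType) (u : K -> S) :
  compact_hausdorff K -> submodule_plot u -> continuous u.
Proof. by move=> hK pu; apply/continuousP => V oV; exact: oV. Qed.

Lemma to_submodule_continuous (Z : topologicalType) (h : Z -> S) :
  k_generated Z ->
  (forall (M : kMod) (f : S -> M), presub_coord D f -> continuous (f \o h)) ->
  continuous h.
Proof.
move=> gZ hf; apply: k_generated_continuous gZ _ => K u hK cu.
apply: submodule_plot_continuous => // M f Df z.
by apply: (@continuous_comp _ _ _ u (f \o h)); [exact: cu | exact: hf].
Qed.

(** Weak Hausdorffness is inherited from the coordinates: equality of two points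
    is the conjunction of the equalities of their coordinates, so the equalizer
    of two test maps is an intersection of closed sets. *)
Lemma submodule_k_space : k_space S.
Proof.
split=> [U kU|K u hK cu].
  change (submodule_open U) => K u hK pu; apply: kU => //.
  exact: submodule_plot_continuous.
rewrite -openC; change (submodule_open (~` range u)) => L v hL pv.
rewrite preimage_setC; apply: closed_openC.
apply: preimage_range_closed => //.
have -> : [set kl : K * L | u kl.1 = v kl.2] =
    \bigcap_(Z in [set Z | exists (M : kMod) (f : S -> M), presub_coord D f /\
       Z = [set kl | f (u kl.1) = f (v kl.2)]]) Z.
  apply/seteqP; split=> [[k l] /= kl _ [M [f [Df ->]]] /=|[k l] /= kl].
    by rewrite kl.
  apply: presub_sep => M f Df.
  by apply: (kl [set kl | f (u kl.1) = f (v kl.2)]); exists M, f.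
apply: closed_bigI => _ [M [f [Df ->]]].
apply: (@weakly_hausdorff_equalizer_closed M K L (f \o u) (f \o v)) => //.
- by case: (@kmod_k_space R G M).
- move=> z; apply: continuous_comp (cu _) _.
  exact: submodule_coord_continuous.
- exact: pv.
Qed.

Lemma submodule_add_continuous :
  continuous (fun xy : kprod S S => xy.1 + xy.2 : S).
Proof.
apply: to_submodule_continuous; first exact: kprod_k_generated.
move=> M f Df; have cf := submodule_coord_continuous Df.
have [_ _ fD _ _] := presub_coord_morph Df.
rewrite (_ : _ \o _ = (fun xy : kprod M M => xy.1 + xy.2) \o
   (fun xy : kprod S S => (f xy.1, f xy.2) : kprod M M)); last first.
  by apply/funext => xy /=; rewrite fD.
move=> z; apply: continuous_comp; last exact: kmod_add_continuous.
exact: kprod_map_continuous.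
Qed.

Lemma submodule_scale_continuous :
  continuous (fun rx : kprod (discrete_topology R) S => (rx.1 : R) *: rx.2 : S).
Proof.
apply: to_submodule_continuous; first exact: kprod_k_generated.
move=> M f Df; have cf := submodule_coord_continuous Df.
have [_ _ _ fZ _] := presub_coord_morph Df.
pose DR := discrete_topology R.
rewrite (_ : _ \o _ = (fun rx : kprod DR M => (rx.1 : R) *: rx.2) \o
   (fun rx : kprod DR S => (rx.1, f rx.2) : kprod DR M)); last first.
  by apply/funext => xy /=; rewrite fZ.
move=> z; apply: continuous_comp; last exact: kmod_scale_continuous.
by apply: (kprod_map_continuous (a := id)) => // r; exact: cvg_id.
Qed.

Lemma submodule_act1 (x : S) : presub_act 1%g x = x.
Proof.
apply: presub_sep => M f /presub_coord_morph[_ _ _ _ fA].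
by rewrite fA gact1.
Qed.

Lemma submodule_actM g h (x : S) :
  presub_act (g * h)%g x = presub_act g (presub_act h x).
Proof.
apply: presub_sep => M f /presub_coord_morph[_ _ _ _ fA].
by rewrite !fA gactM.
Qed.

Lemma submodule_act_linear g : linear (@presub_act R G D g : S -> S).
Proof.
move=> r x y; apply: presub_sep => M f /presub_coord_morph[_ _ fD fZ fA].
by rewrite fA !fD !fZ !fA gact_linear.
Qed.

Lemma submodule_act_continuous :
  continuous (fun gx : kprod G S => presub_act gx.1 gx.2 : S).
Proof.
apply: to_submodule_continuous; first exact: kprod_k_generated.
move=> M f Df; have cf := submodule_coord_continuous Df.
have [_ _ _ _ fA] := presub_coord_morph Df.
rewrite (_ : _ \o _ = (fun gx : kprod G M => gact gx.1 gx.2) \o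
   (fun gx : kprod G S => (gx.1, f gx.2) : kprod G M)); last first.
  by apply/funext => xy /=; rewrite fA.
move=> z; apply: continuous_comp; last exact: gact_continuous.
by apply: (kprod_map_continuous (a := id)) => // r; exact: cvg_id.
Qed.

HB.instance Definition _ := isKModule.Build R G S submodule_k_space
  submodule_add_continuous submodule_scale_continuous
  submodule_act1 submodule_actM submodule_act_linear submodule_act_continuous.

Lemma submodule_coord_kmorphism (M : kMod) (f : S -> M) :
  presub_coord D f -> kmorphism f.
Proof.
move=> Df; have [_ _ fD fZ fA] := presub_coord_morph Df.
split; [|exact: submodule_coord_continuous|exact: fA].
by move=> r x y; rewrite [LHS]fD [X in X + _]fZ.
Qed.

End Submodule.

(** * Morphisms, kernels and direct sums *)

Section Morphisms.
Variables (R : comPzRingType) (G : topGroupType).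
Local Notation kMod := (kModType R G).

Lemma gactD (A : kMod) h : {morph (gact h : A -> A) : x y / x + y}.
Proof. by move=> x y; have := @gact_linear R G A h 1 x y; rewrite !scale1r. Qed.

Lemma gact0 (A : kMod) h : gact h (0 : A) = 0.
Proof. by apply: (addrI (gact h (0 : A))); rewrite -gactD !addr0. Qed.

Lemma gactN (A : kMod) h : {morph (gact h : A -> A) : x / - x}.
Proof.
by move=> x; apply: (addrI (gact h x)); rewrite -gactD !subrr gact0.
Qed.

Section Kmorphism.
Variables (A B : kMod) (f : A -> B).
Hypothesis kf : kmorphism f.

Lemma kmorphism_continuous : continuous f. Proof. by case: kf. Qed.

Lemma kmorphD : {morph f : x y / x + y}.
Proof. by case: kf => lf _ _ x y; have := lf 1 x y; rewrite !scale1r. Qed.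

Lemma kmorph0 : f 0 = 0.
Proof. by apply: (addrI (f 0)); rewrite -kmorphD !addr0. Qed.

Lemma kmorphZ r : {morph f : x / r *: x}.
Proof.
by case: kf => lf _ _ x; have := lf r x 0; rewrite kmorph0 !addr0.
Qed.

Lemma kmorphN : {morph f : x / - x}.
Proof. by move=> x; rewrite -scaleN1r kmorphZ scaleN1r. Qed.

Lemma kmorphB : {morph f : x y / x - y}.
Proof. by move=> x y; rewrite kmorphD kmorphN. Qed.

Lemma kmorphA g : {morph f : x / gact g x >-> gact g x}.
Proof. by case: kf => _ _ fA x; exact: fA. Qed.

End Kmorphism.

Lemma comp_kmorphism_continuous (L : topologicalType) (A B : kMod) (u : L -> A)
    (f : A -> B) :
  kmorphism f -> continuous u -> continuous (f \o u).
Proof.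
move=> kf cu x; apply: continuous_comp; first exact: cu.
exact: kmorphism_continuous.
Qed.

Lemma kmorphism_id (A : kMod) : kmorphism (id : A -> A).
Proof. by split => // x; exact: cvg_id. Qed.

Lemma kmorphism0 (A B : kMod) : kmorphism (fun _ : A => 0 : B).
Proof.
split=> [r x y|x|h x]; first by rewrite scaler0 addr0.
  exact: cvg_cst.
by rewrite gact0.
Qed.

Lemma kmorphism_comp (A B C : kMod) (f : A -> B) (g : B -> C) :
  kmorphism f -> kmorphism g -> kmorphism (g \o f).
Proof.
move=> kf kg; split=> [r x y|x|h x] /=.
- by rewrite (kmorphD kf) (kmorphZ kf) (kmorphD kg) (kmorphZ kg).
- exact: (comp_kmorphism_continuous kg (kmorphism_continuous kf)).
- by rewrite (kmorphA kf) (kmorphA kg).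
Qed.

Lemma kmod_k_generated (A : kMod) : k_generated A.
Proof. by case: (@kmod_k_space R G A). Qed.

Lemma kmod_weakly_hausdorff (A : kMod) : weakly_hausdorff A.
Proof. by case: (@kmod_k_space R G A). Qed.

Lemma addk_continuous (K : topologicalType) (A : kMod) (u v : K -> A) :
  k_generated K -> continuous u -> continuous v ->
  continuous (fun x => u x + v x).
Proof.
move=> gK cu cv x.
apply: (@continuous_comp _ _ _ (fun x => (u x, v x) : kprod A A)
  (fun xy : kprod A A => xy.1 + xy.2)); last exact: kmod_add_continuous.
exact: kprod_pair_continuous.
Qed.

Lemma oppk_continuous (K : topologicalType) (A : kMod) (u : K -> A) :
  k_generated K -> continuous u -> continuous (fun x => - u x).
Proof.
move=> gK cu.
rewrite (_ : (fun x => - u x) = (fun rx : kprod (discrete_topology R) A =>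
  (rx.1 : R) *: rx.2) \o (fun x => (-1, u x) : kprod (discrete_topology R) A)).
  move=> x; apply: continuous_comp; last exact: kmod_scale_continuous.
  by apply: kprod_pair_continuous => // y; exact: cvg_cst.
by apply/funext => x /=; rewrite scaleN1r.
Qed.

Lemma subk_continuous (K : topologicalType) (A : kMod) (u v : K -> A) :
  k_generated K -> continuous u -> continuous v ->
  continuous (fun x => u x - v x).
Proof.
by move=> gK cu cv; apply: addk_continuous => //; exact: oppk_continuous.
Qed.

Lemma kmorphism_sub (A B : kMod) (f g : A -> B) :
  kmorphism f -> kmorphism g -> kmorphism (fun x => f x - g x).
Proof.
move=> kf kg; split=> [r x y||h x].
- rewrite (kmorphD kf) (kmorphD kg) (kmorphZ kf) (kmorphZ kg).
  by rewrite scalerBr opprD addrACA.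
- by apply: subk_continuous;
    [exact: kmod_k_generated|exact: kmorphism_continuous..].
- rewrite (kmorphA kf) (kmorphA kg).
  by rewrite gactD gactN.
Qed.

Section Kernel.
Variables (A B : kMod) (g : A -> B) (kg : kmorphism g).

Let ker := {x : A | g x == 0}.

Let ker_zero : ker := exist _ 0 (introT eqP (kmorph0 kg)).

Let ker_oppP (x : ker) : g (- val x) == 0.
Proof. by rewrite (kmorphN kg) (eqP (valP x)) oppr0. Qed.

Let ker_addP (x y : ker) : g (val x + val y) == 0.
Proof. by rewrite (kmorphD kg) (eqP (valP x)) (eqP (valP y)) addr0. Qed.

Let ker_scaleP r (x : ker) : g (r *: val x) == 0.
Proof. by rewrite (kmorphZ kg) (eqP (valP x)) scaler0. Qed.

Let ker_actP h (x : ker) : g (gact h (val x)) == 0.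
Proof. by rewrite (kmorphA kg) (eqP (valP x)) gact0. Qed.

Let ker_opp (x : ker) : ker := exist (fun z => g z == 0) _ (ker_oppP x).
Let ker_add (x y : ker) : ker := exist (fun z => g z == 0) _ (ker_addP x y).
Let ker_scale r (x : ker) : ker := exist (fun z => g z == 0) _ (ker_scaleP r x).
Let ker_act h (x : ker) : ker := exist (fun z => g z == 0) _ (ker_actP h x).

(* All restrictions of morphisms from A serve as coordinates; the inclusion is
   one of them, and the others factor through it. *)
Let ker_coord (M : kMod) (f : ker -> M) :=
  exists e : A -> M, kmorphism e /\ f = e \o val.

Let ker_coord_morph (M : kMod) (f : ker -> M) : ker_coord f ->
    [/\ f ker_zero = 0, {morph f : x / ker_opp x >-> - x},
        {morph f : x y / ker_add x y >-> x + y},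
        forall r, {morph f : x / ker_scale r x >-> r *: x} &
        forall h, {morph f : x / ker_act h x >-> gact h x}].
Proof.
move=> [e [ke ->]]; split=> [|x|x y|r x|h x] /=.
- exact: kmorph0.
- exact: kmorphN.
- exact: kmorphD.
- exact: kmorphZ.
- exact: kmorphA.
Qed.

Let ker_sep x y : (forall (M : kMod) (f : ker -> M),
  ker_coord f -> f x = f y) -> x = y.
Proof.
move=> xy; apply/val_inj/(xy A val); exists id; split=> //.
exact: kmorphism_id.
Qed.

Definition kernel : kMod := submodule (PreSubmodule ker_coord_morph ker_sep).

Definition kernel_val : kernel -> A := val.

Lemma kernel_valP x : g (kernel_val x) = 0.
Proof. exact: (eqP (valP (x : ker))). Qed.

Lemma kernel_val_inj : injective kernel_val.
Proof. exact: (@val_inj _ _ ker). Qed.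

Lemma kernel_val_kmorphism : kmorphism kernel_val.
Proof.
apply: submodule_coord_kmorphism; exists id; split=> //.
exact: kmorphism_id.
Qed.

Lemma kernel_val_onto x : g x = 0 -> exists y, kernel_val y = x.
Proof. by move=> gx; exists (exist _ x (introT eqP gx)). Qed.

Lemma kernel_val_initial (K : topologicalType) (u : K -> kernel) :
  k_generated K -> continuous (kernel_val \o u) -> continuous u.
Proof.
move=> gK cu; apply: to_submodule_continuous => // M f [e [ke ->]].
exact: (comp_kmorphism_continuous ke cu).
Qed.

End Kernel.

Section DirectSum.
Variables A B : kMod.

Let dsum_coord (M : kMod) (f : A * B -> M) :=
  (exists e : A -> M, kmorphism e /\ f = e \o fst) \/
  (exists e : B -> M, kmorphism e /\ f = e \o snd).

Let dsum_coord_morph (M : kMod) (f : A * B -> M) : dsum_coord f ->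
    [/\ f (0, 0) = 0, {morph f : x / (- x.1, - x.2) >-> - x},
        {morph f : x y / (x.1 + y.1, x.2 + y.2) >-> x + y},
        forall r, {morph f : x / (r *: x.1, r *: x.2) >-> r *: x} &
        forall g, {morph f : x / (gact g x.1, gact g x.2) >-> gact g x}].
Proof.
case=> -[e [ke ->]]; split=> [|x|x y|r x|h x] /=.
all: by [exact: kmorph0|exact: kmorphN|exact: kmorphD|exact: kmorphZ|
  exact: kmorphA].
Qed.

Let dsum_sep x y : (forall (M : kMod) (f : A * B -> M),
  dsum_coord f -> f x = f y) -> x = y.
Proof.
case: x y => [a b] [a' b'] ff; congr (_, _).
- by apply: (ff A fst); left; exists id; split=> //; exact: kmorphism_id.
- by apply: (ff B snd); right; exists id; split=> //; exact: kmorphism_id.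
Qed.

Definition dsum : kMod := submodule (PreSubmodule dsum_coord_morph dsum_sep).

Definition dsum_pair (a : A) (b : B) : dsum := (a, b).
Definition dsum_fst : dsum -> A := fst.
Definition dsum_snd : dsum -> B := snd.

Lemma dsum_eta (z : dsum) : dsum_pair (dsum_fst z) (dsum_snd z) = z.
Proof. by case: z. Qed.

Lemma dsum_fst_kmorphism : kmorphism dsum_fst.
Proof.
apply: submodule_coord_kmorphism; left; exists id; split=> //.
exact: kmorphism_id.
Qed.

Lemma dsum_snd_kmorphism : kmorphism dsum_snd.
Proof.
apply: submodule_coord_kmorphism; right; exists id; split=> //.
exact: kmorphism_id.
Qed.

Lemma dsum_pair_continuous (K : topologicalType) (a : K -> A) (b : K -> B) :
  k_generated K -> continuous a -> continuous b ->
  continuous (fun x => dsum_pair (a x) (b x)).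
Proof.
move=> gK ca cb; apply: to_submodule_continuous => // M f.
case=> -[e [ke ->]].
- exact: (comp_kmorphism_continuous ke ca).
- exact: (comp_kmorphism_continuous ke cb).
Qed.

Lemma dsum_pair_kmorphism (C : kMod) (a : C -> A) (b : C -> B) :
  kmorphism a -> kmorphism b -> kmorphism (fun x => dsum_pair (a x) (b x)).
Proof.
move=> ka kb; split=> [r x y||h x].
- by rewrite (kmorphD ka) (kmorphD kb) (kmorphZ ka) (kmorphZ kb).
- by apply: dsum_pair_continuous;
    [exact: kmod_k_generated|exact: kmorphism_continuous..].
- by rewrite (kmorphA ka) (kmorphA kb).
Qed.

Definition dsum_inl (a : A) : dsum := dsum_pair a 0.
Definition dsum_inr (b : B) : dsum := dsum_pair 0 b.

Lemma dsum_inl_kmorphism : kmorphism dsum_inl.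
Proof.
exact: (dsum_pair_kmorphism (@kmorphism_id _) (@kmorphism0 _ _)).
Qed.

Lemma dsum_inr_kmorphism : kmorphism dsum_inr.
Proof.
exact: (dsum_pair_kmorphism (@kmorphism0 _ _) (@kmorphism_id _)).
Qed.

Lemma dsum_inlDinr (a : A) (b : B) : dsum_inl a + dsum_inr b = dsum_pair a b.
Proof.
change ((a + 0, 0 + b) = (a, b) :> A * B).
by rewrite addr0 add0r.
Qed.

Definition dsum_case (C : kMod) (a : A -> C) (b : B -> C) (z : dsum) : C :=
  a (dsum_fst z) + b (dsum_snd z).

Lemma dsum_case_kmorphism (C : kMod) (a : A -> C) (b : B -> C) :
  kmorphism a -> kmorphism b -> kmorphism (dsum_case a b).
Proof.
move=> ka kb.
have k1 := kmorphism_comp dsum_fst_kmorphism ka.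
have k2 := kmorphism_comp dsum_snd_kmorphism kb.
split=> [r x y||h x]; rewrite /dsum_case.
- rewrite [a _](kmorphD k1) [b _](kmorphD k2) (kmorphZ k1) (kmorphZ k2) /=.
  by rewrite scalerDr addrACA.
- by apply: addk_continuous;
    [exact: kmod_k_generated|exact: kmorphism_continuous..].
- rewrite [a _](kmorphA k1) [b _](kmorphA k2) /=.
  by rewrite gactD.
Qed.

End DirectSum.

End Morphisms.

(** * Free modules *)

Section FreeModule.
Variables (R : comPzRingType) (G : topGroupType) (Y : topologicalType).
Local Notation kMod := (kModType R G).

(** Formal module expressions in variables from [Y].  The free module is the
    quotient of these by the equations which hold, for every continuous
    assignment of the variables, in every k-module.  Elements of the abstract
    free module over the group ring that no continuous assignment separates are
    thereby identified, as they have to be in a k-module generated by [Y]. *)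
Inductive free_term :=
| FreeVar of Y
| FreeZero
| FreeOpp of free_term
| FreeAdd of free_term & free_term
| FreeScale of R & free_term
| FreeAct of G & free_term.

HB.instance Definition _ := gen_eqMixin free_term.
HB.instance Definition _ := gen_choiceMixin free_term.

Fixpoint free_eval (M : kMod) (phi : Y -> M) (t : free_term) : M :=
  match t with
  | FreeVar y => phi y
  | FreeZero => 0
  | FreeOpp t => - free_eval phi t
  | FreeAdd t t' => free_eval phi t + free_eval phi t'
  | FreeScale r t => r *: free_eval phi t
  | FreeAct h t => gact h (free_eval phi t)
  end.

Definition free_equiv (t t' : free_term) : bool :=
  `[< forall (M : kMod) (phi : Y -> M), continuous phi ->
        free_eval phi t = free_eval phi t' >].

Lemma free_equiv_is_equiv : equiv_class_of free_equiv.
Proof.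
split=> [t|t t'|t2 t1 t3].
- exact/asboolP.
- by apply/asboolP/asboolP => tt' M phi cphi; rewrite tt'.
- move=> /asboolP t12 /asboolP t23; apply/asboolP => M phi cphi.
  by rewrite t12 ?t23.
Qed.

Canonical free_equiv_rel := EquivRelPack free_equiv_is_equiv.

Definition free_class : Type := {eq_quot free_equiv}.
HB.instance Definition _ := Choice.on free_class.

Definition free_of_term (t : free_term) : free_class :=
  \pi_({eq_quot free_equiv}) t.

Definition free_eval_class (M : kMod) (phi : Y -> M) (q : free_class) : M :=
  free_eval phi (repr (q : {eq_quot free_equiv})).

Lemma free_eval_of_term (M : kMod) (phi : Y -> M) t :
  continuous phi -> free_eval_class phi (free_of_term t) = free_eval phi t.
Proof.
move=> cphi; rewrite /free_eval_class /free_of_term.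
by case: piP => t' /eqmodP /asboolP ->.
Qed.

Lemma free_of_termK (q : free_class) :
  free_of_term (repr (q : {eq_quot free_equiv})) = q.
Proof. exact: reprK. Qed.

Let lift1 (F : free_term -> free_term) (q : free_class) : free_class :=
  free_of_term (F (repr (q : {eq_quot free_equiv}))).

Let free_add (q q' : free_class) : free_class :=
  free_of_term (FreeAdd (repr (q : {eq_quot free_equiv}))
    (repr (q' : {eq_quot free_equiv}))).

Let free_coord (M : kMod) (f : free_class -> M) :=
  exists phi : Y -> M, continuous phi /\ f = free_eval_class phi.

Let free_coord_morph (M : kMod) (f : free_class -> M) : free_coord f ->
    [/\ f (free_of_term FreeZero) = 0, {morph f : q / lift1 FreeOpp q >-> - q},
        {morph f : q q' / free_add q q' >-> q + q'},
        forall r, {morph f : q / lift1 (FreeScale r) q >-> r *: q} &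
        forall h, {morph f : q / lift1 (FreeAct h) q >-> gact h q}].
Proof.
move=> [phi [cphi ->]].
by split=> [|q|q q'|r q|h q]; rewrite free_eval_of_term.
Qed.

Let free_sep q q' : (forall (M : kMod) (f : free_class -> M),
  free_coord f -> f q = f q') -> q = q'.
Proof.
move=> qq; rewrite -(free_of_termK q) -(free_of_termK q').
apply/eqmodP/asboolP => M phi cphi.
by apply: (qq M (free_eval_class phi)); exists phi.
Qed.

Definition free_module : kMod :=
  submodule (PreSubmodule free_coord_morph free_sep).

Definition free_var (y : Y) : free_module := free_of_term (FreeVar y).

(** Every class is the value of an expression, so a morphism is determined by
    its values on the variables. *)
Lemma kmorphism_free_eval (M : kMod) (psi : free_module -> M) (t : free_term) :
  kmorphism psi -> continuous (psi \o free_var) ->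
  psi (free_of_term t) = free_eval (psi \o free_var) t.
Proof.
move=> kpsi cpsi.
pose F t : free_module := free_of_term t.
have sepF (x y : free_module) :
    (forall (M : kMod) (phi : Y -> M), continuous phi ->
       free_eval_class phi x = free_eval_class phi y) -> x = y.
  by move=> xy; apply: free_sep => N _ [phi [cphi ->]]; exact: xy.
have F0 : F FreeZero = 0 by [].
have mor (N : kMod) (phi : Y -> N) : continuous phi ->
    kmorphism (free_eval_class phi : free_module -> N).
  by move=> cphi; apply: submodule_coord_kmorphism; exists phi.
have FN s : F (FreeOpp s) = - F s.
  apply: sepF => N phi cphi.
  by rewrite (kmorphN (mor _ _ cphi)) !free_eval_of_term.
have FD s s' : F (FreeAdd s s') = F s + F s'.
  apply: sepF => N phi cphi.
  by rewrite (kmorphD (mor _ _ cphi)) !free_eval_of_term.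
have FZ r s : F (FreeScale r s) = r *: F s.
  apply: sepF => N phi cphi.
  by rewrite (kmorphZ (mor _ _ cphi)) !free_eval_of_term.
have FA h s : F (FreeAct h s) = gact h (F s).
  apply: sepF => N phi cphi.
  by rewrite (kmorphA (mor _ _ cphi)) !free_eval_of_term.
rewrite -/(F t); elim: t => [y||s IH|s IH s' IH'|r s IH|h s IH] //=.
- by rewrite F0 kmorph0.
- by rewrite FN (kmorphN kpsi) IH.
- by rewrite FD (kmorphD kpsi) IH IH'.
- by rewrite FZ (kmorphZ kpsi) IH.
- by rewrite FA (kmorphA kpsi) IH.
Qed.

Lemma free_is_free : k_generated Y -> is_free_on free_var.
Proof.
move=> gY; have cvar : continuous free_var.
  apply: to_submodule_continuous => // M _ [phi [cphi ->]].
  suff -> : free_eval_class phi \o free_var = phi by [].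
  by apply/funext => y /=; rewrite free_eval_of_term.
split=> // M phi cphi; exists (free_eval_class phi); split.
  split; first by apply: submodule_coord_kmorphism; exists phi.
  by apply/funext => y /=; rewrite free_eval_of_term.
move=> psi [kpsi psivar]; apply/funext => q.
rewrite -(free_of_termK q) free_eval_of_term// kmorphism_free_eval//.
  by rewrite psivar.
by rewrite psivar.
Qed.

End FreeModule.

(** * CH-split morphisms and kernels, tested on compact Hausdorff spaces *)

Section Criteria.
Variables (R : comPzRingType) (G : topGroupType).
Local Notation kMod := (kModType R G).

Definition plot_split (A B : kMod) (g : A -> B) := kmorphism g /\
  forall (K : topologicalType) (u : K -> B),
    compact_hausdorff K -> continuous u ->
    exists v : K -> A, continuous v /\ g \o v = u.

(** [k] is an embedding onto the kernel of [g] as far as compact Hausdorff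
    spaces can see: a map from such a space into [K] is continuous as soon as
    it is continuous into [A]. *)
Definition plot_kernel (K A B : kMod) (k : K -> A) (g : A -> B) :=
  [/\ kmorphism k, injective k, (forall x, g x = 0 <-> exists y, k y = x) &
   forall (L : topologicalType) (u : L -> K),
     compact_hausdorff L -> continuous (k \o u) -> continuous u].

Lemma free_ext (Y : topologicalType) (F M : kMod) (eta : Y -> F)
    (f g : F -> M) :
  is_free_on eta -> kmorphism f -> kmorphism g -> f \o eta = g \o eta -> f = g.
Proof.
move=> [ceta univ] kf kg fg.
have [psi [_ uniq]] := univ M _ (comp_kmorphism_continuous kf ceta).
by rewrite -(uniq f)// -(uniq g).
Qed.

Lemma projective_free (I : choiceType) (X : I -> topologicalType) (F : kMod)
    (eta : {i & X i} -> F) :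
  (forall i, compact_hausdorff (X i)) -> is_free_on eta -> projective F.
Proof.
move=> hX Feta; exists I, X, F, eta; split=> //.
(* A zero module is needed as the complement: the kernel of the identity. *)
pose Z := kernel (kmorphism_id F).
exists Z, id, id, (fun=> 0), (fun=> 0); split.
  by split; [exact: kmorphism_id..|exact: kmorphism0|exact: kmorphism0].
split=> //; last by move=> x; rewrite addr0.
apply/funext => x /=; apply: (@kernel_val_inj _ _ _ _ _ (kmorphism_id F)).
by apply: (etrans (kernel_valP (0 : Z))); exact: esym (kernel_valP x).
Qed.

(** Morphisms from a free module on a disjoint union are families of maps from
    its compact Hausdorff pieces, and lifting passes to direct summands. *)
Lemma ch_splitP (A B : kMod) (g : A -> B) : ch_split g <-> plot_split g.
Proof.
split=> [[kg lift]|[kg lift]]; split=> //.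
  move=> K u hK cu.
  have hK1 (i : unit) : compact_hausdorff K by [].
  have Ffree := free_is_free R G (sigT_k_generated hK1).
  have cu1 : continuous (fun z : {i : unit & K} => u (projT2 z)).
    by move=> [i k] U nU; exact: cu nU.
  have [h [[kh hu] _]] := Ffree.2 B _ cu1.
  have [h' [kh' hh']] := lift _ h (projective_free hK1 Ffree) kh.
  exists (h' \o (@free_var R G _ \o existT (fun=> K : Type) tt)); split.
    have cin : continuous (fun k => existT (fun=> K : Type) tt k).
      exact: (@existT_continuous unit (fun=> K)).
    apply: comp_kmorphism_continuous kh' _ => k.
    by apply: continuous_comp; [exact: cin|exact: Ffree.1].
  apply/funext => k /=; rewrite -[LHS]/((g \o h') _) hh'.
  by rewrite -[LHS]/((h \o _) (existT _ tt k)) hu.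
move=> P h [I [X [F [eta [hX Feta summ]]]]] kh.
have [Q [iP [pP [iQ [pQ [[kiP kpP _ _] [pi1 _ _]]]]]]] := summ.
have kf : kmorphism (h \o pP) by exact: kmorphism_comp.
have ci i : continuous (h \o pP \o (eta \o existT X i)).
  apply: comp_kmorphism_continuous kf _ => x.
  apply: (@continuous_comp _ _ _ (existT X i) eta); last exact: Feta.1.
  exact: existT_continuous.
have lifti i := cid (lift _ _ (hX i) (ci i)).
pose v i := sval (lifti i).
have cv : continuous (fun z => v (projT1 z) (projT2 z)).
  by move=> [i x] U nU; have [cvi _] := svalP (lifti i); exact: cvi nU.
have [h1 [[kh1 h1eta] _]] := Feta.2 A _ cv.
exists (h1 \o iP); split; first exact: kmorphism_comp.
have gh1 : g \o h1 = h \o pP.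
  apply: (free_ext Feta) => //; first exact: kmorphism_comp.
  rewrite -compA h1eta; apply/funext => -[i x] /=.
  by have [_ /(congr1 (@^~ x))] := svalP (lifti i).
by rewrite compA gh1 -compA pi1.
Qed.

(** The concrete kernel satisfies the right-hand side, and any map satisfying it
    has the universal property, since continuity of the induced map is tested
    on compact Hausdorff spaces.  An arbitrary kernel is then isomorphic to the
    concrete one. *)
Lemma is_kernelP (K A B : kMod) (k : K -> A) (g : A -> B) :
  kmorphism g -> is_kernel k g <-> plot_kernel k g.
Proof.
move=> kg.
have plot_is_kernel (K' : kMod) (k' : K' -> A) :
    plot_kernel k' g -> is_kernel k' g.
  move=> [kk injk imk ini]; split=> // [x|C h kh gh].
    by apply/imk; exists x.
  have im c : exists y, k' y = h c by apply/imk/gh.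
  pose h' c := sval (cid (im c)).
  have kh' c : k' (h' c) = h c by exact: svalP (cid (im c)).
  exists h'; split.
    split; last exact/funext.
    split=> [r x y||s x].
    - apply: injk; rewrite (kmorphD kk) (kmorphZ kk) !kh'.
      by rewrite (kmorphD kh) (kmorphZ kh).
    - apply: k_generated_continuous (@kmod_k_generated _ _ C) _ => L u hL cu.
      apply: ini hL _; rewrite (_ : k' \o _ = h \o u); last first.
        by apply/funext => x /=; rewrite kh'.
      exact: comp_kmorphism_continuous.
    - by apply: injk; rewrite (kmorphA kk) !kh' (kmorphA kh).
  move=> h2 [_ h2h]; apply/funext => c; apply: injk.
  by rewrite kh' -h2h.
split; last exact: plot_is_kernel.
have pk : plot_kernel (@kernel_val _ _ _ _ _ kg) g.
  split; [exact: kernel_val_kmorphism|exact: kernel_val_inj| |].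
  - move=> x; split=> [|[y <-]]; [exact: kernel_val_onto|exact: kernel_valP].
  - move=> L u hL; apply: kernel_val_initial.
    exact: compact_hausdorff_k_generated.
have [kv v0 univ] := plot_is_kernel _ _ pk.
move=> [kk k0 kuniv].
have [e [[ke ve] _]] := univ K k kk k0.
have [d [[kd kdv] _]] := kuniv _ _ kv v0.
have ed : e \o d = id.
  have [j [_ uniq]] := univ _ (@kernel_val _ _ _ _ _ kg) kv v0.
  rewrite -(uniq (e \o d)) ?(uniq id)//.
    by split=> //; exact: kmorphism_id.
  by split; [exact: kmorphism_comp|rewrite compA ve].
have de : d \o e = id.
  have [j [_ uniq]] := kuniv _ k kk k0.
  rewrite -(uniq (d \o e)) ?(uniq id)//.
    by split=> //; exact: kmorphism_id.
  by split; [exact: kmorphism_comp|rewrite compA kdv].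
have [_ injv imv iniv] := pk.
split=> // [x y kxy|x|L u hL cu].
- have : e x = e y.
    by apply: injv; rewrite -[LHS]/((_ \o e) x) -[RHS]/((_ \o e) y) ve.
  by move=> /(congr1 d); rewrite -![d (e _)]/((d \o e) _) de.
- rewrite imv; split=> -[y <-].
    by exists (d y); rewrite -[LHS]/((k \o d) y) kdv.
  by exists (e y); rewrite -[LHS]/((_ \o e) y) ve.
- have -> : u = d \o (e \o u) by rewrite compA de.
  have ceu : continuous (e \o u) by apply: iniv => //; rewrite compA ve.
  exact: comp_kmorphism_continuous.
Qed.

End Criteria.

(** * Partial resolutions and extensions *)

Section Homological.
Variables (R : comPzRingType) (G : topGroupType).
Local Notation kMod := (kModType R G).

Lemma plot_kernel_factor (K A B C : kMod) (k : K -> A) (g : A -> B)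
    (h : C -> A) :
  kmorphism g -> plot_kernel k g -> kmorphism h -> (forall x, g (h x) = 0) ->
  exists h' : C -> K, kmorphism h' /\ forall x, k (h' x) = h x.
Proof.
move=> kg /(is_kernelP k kg) [_ _ univ] kh gh.
have [h' [[kh' <-] _]] := univ C h kh gh.
by exists h'.
Qed.

Lemma plot_kernel_lift (K A B : kMod) (k : K -> A) (g : A -> B)
    (L : topologicalType) (u : L -> A) :
  plot_kernel k g -> compact_hausdorff L -> continuous u ->
  (forall x, g (u x) = 0) ->
  exists v : L -> K, continuous v /\ forall x, k (v x) = u x.
Proof.
move=> [kk injk imk ini] hL cu gu.
have im c : exists y, k y = u c by apply/imk/gu.
pose v c := sval (cid (im c)).
have kv c : k (v c) = u c by exact: svalP (cid (im c)).
exists v; split=> //; apply: ini => //.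
by rewrite (_ : k \o v = u)//; exact/funext.
Qed.

Lemma plot_kernel0 (K A B : kMod) (k : K -> A) (g : A -> B) x :
  plot_kernel k g -> g (k x) = 0.
Proof. by case=> _ _ imk _; apply/imk; exists x. Qed.

Lemma kernel_plot_kernel (A B : kMod) (g : A -> B) (kg : kmorphism g) :
  plot_kernel (@kernel_val _ _ _ _ _ kg) g.
Proof.
split; [exact: kernel_val_kmorphism|exact: kernel_val_inj| |].
- move=> x; split=> [|[y <-]]; [exact: kernel_val_onto|exact: kernel_valP].
- move=> L u hL; apply: kernel_val_initial.
  exact: compact_hausdorff_k_generated.
Qed.

Lemma plot_split_surj (A B : kMod) (g : A -> B) :
  plot_split g -> forall y, exists x, g x = y.
Proof.
move=> [_ lift] y.
have cy : continuous (fun _ : one_point => y) by exact: cst_continuous.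
have [v [_ /(congr1 (@^~ tt)) gv]] :=
  lift one_point _ compact_hausdorff_one_point cy.
by exists (v tt).
Qed.

Lemma plot_split_comp (A B C : kMod) (f : A -> B) (g : B -> C) :
  plot_split f -> plot_split g -> plot_split (g \o f).
Proof.
move=> [kf lf] [kg lg]; split=> [|K u hK cu]; first exact: kmorphism_comp.
have [v [cv <-]] := lg K u hK cu; have [w [cw <-]] := lf K v hK cv.
by exists w.
Qed.

Lemma plot_split_section (A B : kMod) (g : A -> B) (s : B -> A) :
  kmorphism g -> kmorphism s -> (forall x, g (s x) = x) -> plot_split g.
Proof.
move=> kg ks gs; split=> // K u hK cu; exists (s \o u); split.
  exact: comp_kmorphism_continuous.
by apply/funext => x /=; rewrite gs.
Qed.

Definition compactly_free (F : kMod) :=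
  exists (K : topologicalType) (eta : K -> F),
    compact_hausdorff K /\ is_free_on eta.

Lemma compactly_free_dsum (E F : kMod) :
  compactly_free E -> compactly_free F -> compactly_free (dsum E F).
Proof.
move=> [K [eta [hK Kfree]]] [L [theta [hL Lfree]]].
pose zeta := sum_map (@dsum_inl _ _ E F \o eta) (@dsum_inr _ _ E F \o theta).
exists {b & sum_space K L b}, zeta; split; first exact: compact_hausdorff_sum.
have czeta : continuous zeta.
  apply: sum_map_continuous => x.
    apply: continuous_comp; first exact: Kfree.1.
    exact/kmorphism_continuous/dsum_inl_kmorphism.
  apply: continuous_comp; first exact: Lfree.1.
  exact/kmorphism_continuous/dsum_inr_kmorphism.
split=> // M phi cphi.
have cl : continuous (phi \o @sum_inl K L).
  by move=> k; apply: continuous_comp; [exact: sum_inl_continuous|exact: cphi].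
have cr : continuous (phi \o @sum_inr K L).
  by move=> k; apply: continuous_comp; [exact: sum_inr_continuous|exact: cphi].
have [a [[ka aE] _]] := Kfree.2 M _ cl.
have [b [[kb bE] _]] := Lfree.2 M _ cr.
exists (dsum_case a b); split.
  split; first exact: dsum_case_kmorphism.
  apply/funext => -[[] k]; rewrite /= /dsum_case /dsum_fst /dsum_snd /=.
    by rewrite (kmorph0 kb) addr0 -[LHS]/((a \o eta) k) aE.
  by rewrite (kmorph0 ka) add0r -[LHS]/((b \o theta) k) bE.
move=> c [kc cE].
have ca : a = c \o @dsum_inl _ _ E F.
  apply: (free_ext Kfree) => //.
    by apply: kmorphism_comp => //; exact: dsum_inl_kmorphism.
  by rewrite aE -cE.
have cb : b = c \o @dsum_inr _ _ E F.
  apply: (free_ext Lfree) => //.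
    by apply: kmorphism_comp => //; exact: dsum_inr_kmorphism.
  by rewrite bE -cE.
apply/funext => -[x y]; rewrite /dsum_case ca cb /= -(kmorphD kc) dsum_inlDinr.
by [].
Qed.

Lemma compactly_free_lift (F A B : kMod) (g : A -> B) (h : F -> B) :
  compactly_free F -> plot_split g -> kmorphism h ->
  exists s : F -> A, kmorphism s /\ forall x, g (s x) = h x.
Proof.
move=> [K [eta [hK Kfree]]] [kg lift] kh.
have [v [cv gv]] := lift K _ hK (comp_kmorphism_continuous kh Kfree.1).
have [s [[ks sv] _]] := Kfree.2 A v cv.
exists s; split=> // x; rewrite -[LHS]/((g \o s) x); congr (_ x).
apply: (free_ext Kfree) => //; first exact: kmorphism_comp.
by rewrite -compA sv.
Qed.

(** A partial resolution of [A] by compactly free modules in degrees [0] to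
    [n - 1], with an arbitrary kernel at the end.  The shift makes the empty
    condition, type KP_{-1}, the base case. *)
Fixpoint cg_resolved (n : nat) (A : kMod) : Prop :=
  if n is m.+1 then
    exists (F K : kMod) (e : F -> A) (k : K -> F),
      [/\ compactly_free F, plot_split e, plot_kernel k e & cg_resolved m K]
  else True.

Lemma cg_resolvedW n A : cg_resolved n.+1 A -> cg_resolved n A.
Proof.
elim: n A => // n IH A [F [K [e [k [cF se kk /IH rK]]]]].
by exists F, K, e, k.
Qed.

Lemma cg_resolved_le m n A : (m <= n)%N -> cg_resolved n A -> cg_resolved m A.
Proof.
move=> /subnK <-; elim: (n - m)%N => // k IH /cg_resolvedW; exact: IH.
Qed.

(** The horseshoe construction.  A lift of the cover of [A''] to [A] and the
    cover of [A'] together give a map from the sum of the two free modules; a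
    test map into [A] is lifted by lifting its image in [A''] first and then
    the difference, which lies in [A'].  The kernels of the three covers form
    an extension of the same kind, to which the induction applies. *)
Lemma cg_resolved_extension n (A' A A'' : kMod) (f : A' -> A) (g : A -> A'') :
  plot_kernel f g -> plot_split g ->
  cg_resolved n A' -> cg_resolved n A'' -> cg_resolved n A.
Proof.
elim: n A' A A'' f g => // n IH A' A A'' f g kerf splitg.
have [kf injf imf _] := kerf; have [kg liftg] := splitg.
move=> [F' [K' [e' [k' [cF' se' kk' rK']]]]].
move=> [F'' [K'' [e'' [k'' [cF'' se'' kk'' rK'']]]]].
have [ke' lifte'] := se'; have [ke'' lifte''] := se''.
have [kk'm injk' imk' inik'] := kk'; have [kk''m injk'' imk'' inik''] := kk''.
have [s [ks gs]] := compactly_free_lift cF'' splitg ke''.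
pose e : dsum F' F'' -> A := dsum_case (f \o e') s.
have ke : kmorphism e.
  by apply: dsum_case_kmorphism => //; exact: kmorphism_comp.
have ge z : g (e z) = e'' (dsum_snd z).
  by rewrite /e /dsum_case (kmorphD kg) /= (plot_kernel0 _ kerf) add0r gs.
(* The part of the lifting that goes through A', used for e and for p. *)
have lift0 (L : topologicalType) (w : L -> A) : compact_hausdorff L ->
    continuous w -> (forall x, g (w x) = 0) ->
    exists v : L -> F', continuous v /\ forall x, f (e' (v x)) = w x.
  move=> hL cw gw; have [w' [cw' fw']] := plot_kernel_lift kerf hL cw gw.
  have [v [cv ev]] := lifte' L w' hL cw'.
  by exists v; split=> // x; rewrite -fw' -ev.
have se : plot_split e.
  split=> // L u hL cu; have gL := compact_hausdorff_k_generated hL.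
  have cgu : continuous (g \o u) by exact: comp_kmorphism_continuous.
  have [v'' [cv'' ev'']] := lifte'' L _ hL cgu.
  have csv : continuous (s \o v'') by exact: comp_kmorphism_continuous.
  have [||v' [cv' ev']] := lift0 L (fun x => u x - s (v'' x)) hL.
  - exact: subk_continuous.
  - move=> x; rewrite (kmorphB kg) gs -[e'' _]/((e'' \o v'') x) ev'' /=.
    exact: subrr.
  exists (fun x => dsum_pair (v' x) (v'' x)); split.
    exact: dsum_pair_continuous.
  by apply/funext => x; rewrite /= /e /dsum_case /= ev' subrK.
pose k := @kernel_val _ _ _ _ _ ke.
have kk : plot_kernel k e by exact: kernel_plot_kernel.
have [kkm injk imk inik] := kk.
exists (dsum F' F''), (kernel ke), e, k; split=> //.
  exact: compactly_free_dsum.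
have [||i [ki ik]] := @plot_kernel_factor _ _ _ K' k e
    (@dsum_inl _ _ F' F'' \o k') ke kk.
- by apply: kmorphism_comp => //; exact: dsum_inl_kmorphism.
- move=> x; rewrite /e /dsum_case /= (plot_kernel0 _ kk') (kmorph0 kf) add0r.
  exact: kmorph0.
have [||p [kp pk]] := @plot_kernel_factor _ _ _ _ k'' e''
    (@dsum_snd _ _ _ _ \o k) ke'' kk''.
- by apply: kmorphism_comp => //; exact: dsum_snd_kmorphism.
- by move=> x; rewrite -ge (plot_kernel0 _ kk) (kmorph0 kg).
apply: (IH K' _ K'' i p) rK' rK''.
- split=> // [x y ixy|x|L u hL cu].
  + apply: injk'; have := congr1 k ixy; rewrite !ik.
    by move=> /(congr1 (@dsum_fst _ _ _ _)).
  + split=> [px|[y <-]].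
    2: by apply: injk''; rewrite pk /= ik (kmorph0 kk''m).
    have kx2 : dsum_snd (k x) = 0 by rewrite -[LHS]pk px (kmorph0 kk''m).
    have /imk'[y ky] : e' (dsum_fst (k x)) = 0.
      apply: injf; rewrite (kmorph0 kf).
      have := plot_kernel0 x kk.
      by rewrite /e /dsum_case /= kx2 (kmorph0 ks) addr0.
    exists y; apply: injk; by rewrite ik -[RHS]dsum_eta kx2 /= ky.
  + apply: inik' => //.
    have -> : k' \o u = @dsum_fst _ _ F' F'' \o (k \o (i \o u)).
      by apply/funext => x /=; rewrite ik.
    apply: comp_kmorphism_continuous; first exact: dsum_fst_kmorphism.
    exact: comp_kmorphism_continuous.
- split=> // L u hL cu; have gL := compact_hausdorff_k_generated hL.
  have cku : continuous (k'' \o u) by exact: comp_kmorphism_continuous.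
  have csku : continuous (s \o (k'' \o u)) by exact: comp_kmorphism_continuous.
  (* The correction term in F' moves (0, k'' u) into the kernel of e. *)
  have [|v' [cv' ev']] := lift0 L _ hL csku.
    by move=> x; rewrite /= gs (plot_kernel0 _ kk'').
  have [||t [ct kt]] := @plot_kernel_lift _ _ _ k e L
     (fun x => dsum_pair (- v' x) (k'' (u x))) kk hL.
  + by apply: dsum_pair_continuous => //; exact: oppk_continuous.
  + move=> x; rewrite /e /dsum_case /= (kmorphN ke') (kmorphN kf) ev'.
    exact: addNr.
  exists t; split=> //; apply/funext => x; apply: injk''.
  by rewrite /= pk /= kt.
Qed.

End Homological.

(** * Quotients and kernels in short exact sequences *)

Section Main.
Variables (R : comPzRingType) (G : topGroupType).
Local Notation kMod := (kModType R G).

(** The cover of [A] also covers [A''], and its kernel over [A''] is an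
    extension of [A'] by its kernel over [A]. *)
Lemma cg_resolved_quotient n (A' A A'' : kMod) (f : A' -> A) (g : A -> A'') :
  plot_kernel f g -> plot_split g ->
  cg_resolved n A' -> cg_resolved n.+1 A -> cg_resolved n.+1 A''.
Proof.
move=> kerf splitg rA' [F [K [e [k [cF se kk rK]]]]].
have [kf injf imf inif] := kerf; have [kg liftg] := splitg.
have [ke lifte] := se; have [kkm injk imk inik] := kk.
have kge := kmorphism_comp ke kg.
pose l := @kernel_val _ _ _ _ _ kge.
have ll : plot_kernel l (g \o e) by exact: kernel_plot_kernel.
have [klm injl iml inil] := ll.
exists F, (kernel kge), (g \o e), l; split=> //; first exact: plot_split_comp.
have [|i [ki ik]] := plot_kernel_factor kge ll kkm.
  by move=> x; rewrite /= (plot_kernel0 _ kk) (kmorph0 kg).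
have [||p [kp pk]] := @plot_kernel_factor _ _ _ _ _ _ f g (e \o l) kg kerf.
- exact: kmorphism_comp.
- by move=> x; exact: (plot_kernel0 x ll).
apply: (cg_resolved_extension (f := i) (g := p)) rK rA'.
- split=> // [x y ixy|x|L u hL cu].
  + by apply: injk; rewrite -!ik ixy.
  + split=> [px|[y <-]]; last first.
      by apply: injf; rewrite pk /= ik (plot_kernel0 _ kk) (kmorph0 kf).
    have /imk[y ky] : e (l x) = 0 by rewrite -[LHS]pk px (kmorph0 kf).
    by exists y; apply: injl; rewrite ik.
  + apply: inik => //.
    have -> : k \o u = l \o (i \o u) by apply/funext => x /=; rewrite ik.
    exact: comp_kmorphism_continuous.
- split=> // L u hL cu.
  have [v [cv ev]] := lifte L _ hL (comp_kmorphism_continuous kf cu).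
  have [|w [cw lw]] := plot_kernel_lift ll hL cv.
    by move=> x; rewrite /= -[e _]/((e \o v) x) ev /= (plot_kernel0 _ kerf).
  exists w; split=> //; apply/funext => x; apply: injf.
  by rewrite /= pk /= lw -[LHS]/((e \o v) x) ev.
Qed.

(** The complement of a retract is a retract too, so one can resolve forever,
    alternating between the two. *)
Lemma cg_resolved_retract n (F P : kMod) (i : P -> F) (q : F -> P) :
  compactly_free F -> kmorphism i -> kmorphism q -> (forall x, q (i x) = x) ->
  cg_resolved n P.
Proof.
move=> cF; elim: n P i q => // n IH P i q ki kq qi.
exists F, (kernel kq), q, (@kernel_val _ _ _ _ _ kq); split=> //.
- exact: plot_split_section qi.
- exact: kernel_plot_kernel.
have kv := kernel_val_kmorphism kq.
have kr : kmorphism (fun x => x - i (q x)).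
  apply: (kmorphism_sub (f := id)); first exact: kmorphism_id.
  exact: kmorphism_comp.
have [|r [kr' vr]] := plot_kernel_factor kq (kernel_plot_kernel kq) kr.
  by move=> x; rewrite (kmorphB kq) qi subrr.
apply: (IH _ (@kernel_val _ _ _ _ _ kq) r) => // x.
apply: (@kernel_val_inj _ _ _ _ _ kq).
by rewrite vr kernel_valP (kmorph0 ki) subr0.
Qed.

Lemma cg_resolved_compactly_free n (F : kMod) :
  compactly_free F -> cg_resolved n F.
Proof.
move=> cF; have kid := @kmorphism_id _ _ F.
exact: (cg_resolved_retract n cF kid kid).
Qed.

(** A Schanuel argument.  For a cover [F] of [A''] with kernel [K], the pullback
    of [F] and [A] over [A''] is an extension of [A] by [K], hence resolved as
    far as both are; and since [F] lifts to [A], it also splits as a sum of [A']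
    and [F], so that [A'] is its quotient by the free module [F]. *)
Lemma cg_resolved_kernel n (A' A A'' : kMod) (f : A' -> A) (g : A -> A'') :
  plot_kernel f g -> plot_split g ->
  cg_resolved n A -> cg_resolved n.+1 A'' -> cg_resolved n A'.
Proof.
case: n => // n kerf splitg rA [F [K [e [k [cF se kk rK]]]]].
have [kf injf imf inif] := kerf; have [kg liftg] := splitg.
have [ke lifte] := se; have [kkm injk imk inik] := kk.
have [s [ks gs]] := compactly_free_lift cF splitg ke.
have kfst := dsum_fst_kmorphism A F; have ksnd := dsum_snd_kmorphism A F.
have kd := kmorphism_sub (kmorphism_comp kfst kg) (kmorphism_comp ksnd ke).
(* The pullback is the kernel of this difference. *)
pose v := @kernel_val _ _ _ _ _ kd.
have vv := kernel_plot_kernel kd; rewrite -/v in vv.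
have [kvm injv imv iniv] := vv.
have vE x : g (dsum_fst (v x)) = e (dsum_snd (v x)).
  apply/eqP; rewrite -subr_eq0; apply/eqP.
  exact: (@kernel_valP _ _ _ _ _ kd x).
pose p := @dsum_fst _ _ A F \o v.
have kp : kmorphism p by exact: kmorphism_comp.
have sp : plot_split p.
  split=> // L u hL cu.
  have [w [cw ew]] := lifte L _ hL (comp_kmorphism_continuous kg cu).
  have [||t [ct vt]] :=
    plot_kernel_lift (u := fun x => dsum_pair (u x) (w x)) vv hL.
  - exact: dsum_pair_continuous (compact_hausdorff_k_generated hL) cu cw.
  - by move=> x /=; rewrite -[e _]/((e \o w) x) ew subrr.
  by exists t; split=> //; apply/funext => x; rewrite /p /= vt.
have [||i [ki iE]] := plot_kernel_factor (h := @dsum_inr _ _ A F \o k) kd vv.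
- by apply: kmorphism_comp => //; exact: dsum_inr_kmorphism.
- by move=> x /=; rewrite (kmorph0 kg) (plot_kernel0 _ kk) subrr.
have kerp : plot_kernel i p.
  split=> // [x y ixy|x|L u hL cu].
  + apply: injk; have := congr1 v ixy; rewrite !iE.
    by move=> /(congr1 (@dsum_snd _ _ _ _)).
  + split=> [px|[y <-]]; last by rewrite /p /= iE.
    have /imk[y ky] : e (dsum_snd (v x)) = 0.
      by rewrite -vE [dsum_fst _]px (kmorph0 kg).
    by exists y; apply: injv; rewrite iE -[RHS]dsum_eta [dsum_fst _]px -ky.
  + apply: inik => //.
    have -> : k \o u = @dsum_snd _ _ A F \o (v \o (i \o u)).
      by apply/funext => x /=; rewrite iE.
    by do 2![apply: comp_kmorphism_continuous => //].
have rE : cg_resolved n.+1 (kernel kd).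
  by apply: (@cg_resolved_extension _ _ _ K _ A i p).
(* The graph of the lift s splits the projection to F; the retraction onto A'
   is a - s x at the point (a, x). *)
have [||j [kj jE]] :=
  plot_kernel_factor (h := fun x => dsum_pair (s x) x) kd vv.
- exact: dsum_pair_kmorphism ks (@kmorphism_id _ _ _).
- by move=> x /=; rewrite gs subrr.
have kh := kmorphism_sub kp (kmorphism_comp (kmorphism_comp kvm ksnd) ks).
have [|q [kq qE]] := plot_kernel_factor kg kerf kh.
  by move=> x; rewrite (kmorphB kg) /= gs -vE subrr.
have kerq : plot_kernel j q.
  split=> // [x y jxy|x|L u hL cu].
  + have := congr1 v jxy; rewrite !jE.
    by move=> /(congr1 (@dsum_snd _ _ _ _)).
  + split=> [qx|[y <-]]; last first.
      by apply: injf; rewrite qE /p /= jE /= subrr (kmorph0 kf).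
    exists (dsum_snd (v x)); apply: injv; rewrite jE -[RHS]dsum_eta.
    congr dsum_pair; apply/eqP; rewrite eq_sym -subr_eq0; apply/eqP.
    by rewrite -[LHS]qE qx (kmorph0 kf).
  + have -> : u = @dsum_snd _ _ A F \o (v \o (j \o u)).
      by apply/funext => x /=; rewrite jE.
    by do 2![apply: comp_kmorphism_continuous => //].
have sq : plot_split q.
  split=> // L u hL cu.
  have [||t [ct vt]] :=
    plot_kernel_lift (u := @dsum_inl _ _ A F \o (f \o u)) vv hL.
  - apply: comp_kmorphism_continuous; first exact: dsum_inl_kmorphism.
    exact: comp_kmorphism_continuous.
  - by move=> x /=; rewrite (plot_kernel0 _ kerf) (kmorph0 ke) subrr.
  exists t; split=> //; apply/funext => x; apply: injf.
  by rewrite /= qE /p /= vt /= (kmorph0 ks) subr0.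
apply: (@cg_resolved_quotient _ F _ _ j q) => //.
exact: cg_resolved_compactly_free.
Qed.

End Main.

(** * Partial resolutions from projective resolutions *)

Section Resolutions.
Variables (R : comPzRingType) (G : topGroupType).
Local Notation kMod := (kModType R G).

Lemma cg_projective_resolved n (P : kMod) :
  projective P -> compactly_generated P -> cg_resolved n P.
Proof.
move=> pP [K [F [eta [q [hK Fk [kq lift] _]]]]].
have [i [ki qi]] := lift P id pP (@kmorphism_id _ _ P).
apply: (@cg_resolved_retract _ _ _ F P i q) => //; first by exists K, eta.
by move=> x; exact: (congr1 (@^~ x) qi).
Qed.

(** The kernel of the augmentation is resolved by the tail of the resolution. *)
Lemma cg_resolved_of_resolution n (A : kMod) (P : nat -> kMod)
    (d : forall i, P i.+1 -> P i) (eps : P 0%N -> A) :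
  (forall i, projective (P i)) -> ch_split eps ->
  ch_split_onto_kernel (d 0%N) eps ->
  (forall i, ch_split_onto_kernel (d i.+1) (d i)) ->
  (forall i, (i <= n)%N -> compactly_generated (P i)) ->
  cg_resolved n.+1 A.
Proof.
elim: n A P d eps => [|n IH] A P d eps pP seps [K [k [e [kk se ke]]]] sd cP.
all: have /ch_splitP[keps leps] := seps; have kk' := (is_kernelP k keps).1 kk.
all: have r0 m : cg_resolved m (P 0%N)
  by apply: cg_projective_resolved => //; exact: cP.
all: apply: (@cg_resolved_quotient _ _ _ _ _ _ k eps) => //.
apply: (IH K (fun i => P i.+1) (fun i => d i.+1) e) => //; last first.
  by move=> i ilen; apply: cP.
have [K1 [k1 [e1 [kk1 se1 ke1]]]] := sd 0%N.
exists K1, k1, e1; split=> //; apply/is_kernelP; first by case: se.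
have [kkm injk imk inik] := kk'; have kem : kmorphism e by case: se.
have kd0 : kmorphism (d 0%N) by rewrite -ke; exact: kmorphism_comp.
have [k1m injk1 imk1 inik1] := (is_kernelP k1 kd0).1 kk1.
split=> // x; rewrite -imk1 -ke /=; split=> [->|]; first exact: kmorph0.
by rewrite -[X in _ = X -> _](kmorph0 kkm); exact: injk.
Qed.

Lemma type_KP_cg_resolved (m : nat) (n : option nat) (A : kMod) :
  le_ext m n -> type_KP n A -> cg_resolved m.+1 A.
Proof.
move=> mn [P [d [eps [[pP kd _ [seps s0 sd]] cP]]]].
apply: (@cg_resolved_of_resolution m A P d eps) => // i im; apply: cP.
by case: n mn => //= n mn; exact: leq_trans mn.
Qed.

Lemma range_compact_hausdorff (K X : topologicalType) (u : K -> X) :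
  weakly_hausdorff X -> compact_hausdorff K -> continuous u ->
  compact_hausdorff (range u).
Proof.
move=> wX hK cu; split.
  apply: compact_set_type; apply: continuous_compact; last by case: hK.
  exact: continuous_subspaceT.
rewrite open_hausdorff => x y xy.
have [|[U V] [/= oU oV Ux Vy UV]] :=
  @separate_points_compact_hausdorff X K u (set_val x) (set_val y) wX hK cu.
  by apply: contra xy => /eqP/val_inj ->.
exists (set_val @^-1` U, set_val @^-1` V) => /=.
  by split; apply/mem_set.
split; [by exists U|by exists V|].
apply/eqP; rewrite -subset0 => z [Uz Vz].
by have [k _ kz] := set_valP z; apply: (UV k); rewrite kz.
Qed.

(** * Covers by compact subspaces, and spliced resolutions *)

(** Enough projectives, with covers chosen canonically: every map from a compact
    Hausdorff space to [A] factors through its image, a compact Hausdorff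
    subspace, so the free module on the disjoint union of all these subspaces
    maps CH-split onto [A].  If [A] is compactly generated, a single subspace
    suffices: the image of a generating compact Hausdorff space.  The choice is
    thus made among the sets of subsets of [A], not among modules, which keeps
    it inside the universe of [A]. *)
Section Cover.
Variable A : kMod.

Definition piece (S : set (set A)) (C : S) : topologicalType :=
  set_type (set_val C).

Definition piece_val (S : set (set A)) (z : {C : S & piece C}) : A :=
  set_val (projT2 z).

Definition in_piece (S : set (set A)) (C : S) (x : piece C) :
    {C : S & piece C} :=
  existT (fun C => piece C : Type) C x.

Lemma in_piece_continuous (S : set (set A)) (C : S) :
  continuous (@in_piece S C).
Proof. exact: (@existT_continuous S (@piece S) C). Qed.

Lemma piece_val_continuous (S : set (set A)) : continuous (@piece_val S).
Proof.
move=> [C x] U nU.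
exact: (@initial_continuous (piece C) A set_val x).
Qed.

Definition cover (S : set (set A)) : kMod := free_module R G {C : S & piece C}.

Definition cover_var (S : set (set A)) : {C : S & piece C} -> cover S :=
  @free_var R G _.

Definition cover_map (S : set (set A)) : cover S -> A :=
  free_eval_class (@piece_val S).

Definition compact_pieces : set (set A) :=
  [set C : set A | compact_hausdorff (set_type C)].

Section Pieces.
Variables (S : set (set A)) (SC : S `<=` compact_pieces).

Lemma piece_compact_hausdorff (C : S) : compact_hausdorff (piece C).
Proof. by apply: SC; exact: set_valP. Qed.

Lemma cover_free : is_free_on (@cover_var S).
Proof.
by apply: free_is_free; apply: sigT_k_generated; exact: piece_compact_hausdorff.
Qed.

Lemma cover_map_var : @cover_map S \o @cover_var S = @piece_val S.
Proof.
apply/funext => z; rewrite /= /cover_map free_eval_of_term//.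
exact: piece_val_continuous.
Qed.

Lemma cover_map_kmorphism : kmorphism (@cover_map S).
Proof.
apply: submodule_coord_kmorphism; exists (@piece_val S); split=> //.
exact: piece_val_continuous.
Qed.

Lemma cover_projective : projective (cover S).
Proof. exact: projective_free piece_compact_hausdorff cover_free. Qed.

Lemma cover_lift (K : topologicalType) (u : K -> A) :
  continuous u -> S (range u) ->
  exists v : K -> cover S, continuous v /\ @cover_map S \o v = u.
Proof.
move=> cu Su.
pose C : S := exist _ (range u) (mem_set Su).
have uC k : u k \in set_val C by apply/mem_set; exists k.
pose w k : piece C := exist _ (u k) (uC k).
have cw : continuous w.
  apply/continuousP => _ [V oV <-].
  by move: V oV; apply/continuousP.
exists (@cover_var S \o (@in_piece S C \o w)); split.
  move=> k; apply: (@continuous_comp _ _ _ (@in_piece S C \o w)).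
  2: exact: cover_free.1.
  by apply: continuous_comp; [exact: cw|exact: in_piece_continuous].
apply/funext => k /=.
by rewrite -[LHS]/((@cover_map S \o @cover_var S) _) cover_map_var.
Qed.

End Pieces.

Definition good_cover (S : set (set A)) :=
  [/\ S `<=` compact_pieces, plot_split (@cover_map S) &
      cg_resolved 1 A -> finite_set [set: S]].

Lemma good_cover_exists : exists S, good_cover S.
Proof.
have [[F [_ [e [_ [[K [eta [hK Kfree]]] [ke lift] _ _]]]]]|nA] :=
  pselect (cg_resolved 1 A).
  have ceeta := comp_kmorphism_continuous ke Kfree.1.
  pose S : set (set A) := [set range (e \o eta)].
  have SC : S `<=` compact_pieces.
    move=> _ ->; apply: range_compact_hausdorff => //.
    exact: kmod_weakly_hausdorff.
  have [v [cv ev]] := cover_lift SC ceeta erefl.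
  have [t [[kt tv] _]] := Kfree.2 _ v cv.
  have kc := cover_map_kmorphism S.
  have te : @cover_map S \o t = e.
    apply: (free_ext Kfree) => //; first exact: kmorphism_comp.
    by rewrite -compA tv.
  exists S; split=> // [|_].
    split=> // L u hL cu; have [w [cw ew]] := lift L u hL cu.
    exists (t \o w); split; first exact: comp_kmorphism_continuous.
    by rewrite compA te.
  pose C : S := exist _ (range (e \o eta)) (mem_set erefl).
  apply: (@sub_finite_set _ _ [set C]) => // D _.
  by apply: val_inj; exact: (set_valP D).
exists compact_pieces; split=> //; split; first exact: cover_map_kmorphism.
move=> L u hL cu; apply: cover_lift => //.
exact: range_compact_hausdorff (@kmod_weakly_hausdorff _ _ A) hL cu.
Qed.

Definition cover_pieces : set (set A) := sval (cid good_cover_exists).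

Lemma good_cover_pieces : good_cover cover_pieces.
Proof. exact: svalP (cid good_cover_exists). Qed.

Definition syzygy_cover : kMod := cover cover_pieces.

Definition syzygy_map : syzygy_cover -> A := @cover_map cover_pieces.

Lemma syzygy_map_plot_split : plot_split syzygy_map.
Proof. by case: good_cover_pieces. Qed.

Definition syzygy_map_kmorphism : kmorphism syzygy_map :=
  syzygy_map_plot_split.1.

Definition syzygy : kMod := kernel syzygy_map_kmorphism.

Definition syzygy_incl : syzygy -> syzygy_cover := @kernel_val _ _ _ _ _ _.

Lemma syzygy_incl_plot_kernel : plot_kernel syzygy_incl syzygy_map.
Proof. exact: kernel_plot_kernel. Qed.

Lemma syzygy_cover_projective : projective syzygy_cover.
Proof. by apply: cover_projective; case: good_cover_pieces. Qed.

Lemma syzygy_cover_compactly_free :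
  cg_resolved 1 A -> compactly_free syzygy_cover.
Proof.
move=> rA; have [Spieces _ /(_ rA) Sfin] := good_cover_pieces.
exists {C : cover_pieces & piece C}, (@cover_var cover_pieces); split.
  by apply: compact_hausdorff_sigT => //; exact: piece_compact_hausdorff.
exact: cover_free.
Qed.

(** The cover is fixed in advance, yet it loses none of the finiteness of
    [A]. *)
Lemma cg_resolved_syzygy n : cg_resolved n.+1 A -> cg_resolved n syzygy.
Proof.
move=> rA.
have cF := syzygy_cover_compactly_free (@cg_resolved_le _ _ 1 n.+1 A erefl rA).
apply: (cg_resolved_kernel syzygy_incl_plot_kernel syzygy_map_plot_split) rA.
exact: cg_resolved_compactly_free.
Qed.

End Cover.

Lemma compactly_free_compactly_generated (F : kMod) :
  compactly_free F -> compactly_generated F.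
Proof.
move=> [K [eta [hK Kfree]]]; exists K, F, eta, id; split=> //.
  apply/ch_splitP; apply: (@plot_split_section _ _ _ _ id id) => //;
    exact: kmorphism_id.
by move=> y; exists y.
Qed.

Lemma splice_resolution (P Z : kMod -> kMod) (incl : forall A, Z A -> P A)
    (aug : forall A, P A -> A) (A : kMod) :
  (forall B, projective (P B)) ->
  (forall B, plot_kernel (@incl B) (@aug B)) ->
  (forall B, plot_split (@aug B)) ->
  projective_resolution (P := fun i => P (iter i Z A))
    (fun i => @incl (iter i Z A) \o @aug (iter i.+1 Z A)) (@aug A).
Proof.
move=> pP kincl saug.
have kaug B : kmorphism (@aug B) by case: (saug B).
have ki B : kmorphism (@incl B) by case: (kincl B).
pose d B : P (Z B) -> P B := @incl B \o @aug (Z B).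
have kd B : kmorphism (d B) by exact: kmorphism_comp.
(* Only the kernel of h matters, so h can be an augmentation, or a
   differential, which is an augmentation followed by an injection. *)
have onto (B C : kMod) (h : P B -> C) : kmorphism h ->
    (forall x, h x = 0 <-> @aug B x = 0) ->
    ch_split_onto_kernel (d B) h /\ exact_at (d B) h.
  move=> kh hE; have [kk injk imk inik] := kincl B.
  split.
    exists (Z B), (@incl B), (@aug (Z B)); split=> //.
      by apply/(is_kernelP _ kh); split=> // x; rewrite hE.
    exact/ch_splitP.
  move=> y; rewrite hE imk; split=> [[z <-]|[x <-]]; last by exists (@aug _ x).
  by have [x <-] := plot_split_surj (saug (Z B)) z; exists x.
have [s0 x0] := onto A A (@aug A) (kaug A) (fun=> iff_refl _).
have sd B : ch_split_onto_kernel (d (Z B)) (d B) /\ exact_at (d (Z B)) (d B).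
  apply: onto => // x; have [_ injk _ _] := kincl B.
  rewrite /d /=; split=> [|->]; last exact: kmorph0.
  by rewrite -[X in _ = X -> _](kmorph0 (ki B)); exact: injk.
split=> //.
- by split=> // i; exact: kd.
- split=> //; first exact: plot_split_surj.
  by move=> i; have [] := sd (iter i Z A).
- split=> //; first exact/ch_splitP.
  by move=> i; have [] := sd (iter i Z A).
Qed.

(** Infinite type follows from all finite ones because the same covers serve
    every [n]. *)
Lemma type_KP_of_cg_resolved (n : option nat) (A : kMod) :
  (forall m, le_ext m n -> cg_resolved m.+1 A) -> type_KP n A.
Proof.
move=> rA.
have rZ j k B : cg_resolved (j + k) B -> cg_resolved k (iter j syzygy B).
  elim: j k => // j IH k; rewrite addSnnS => /IH.
  exact: cg_resolved_syzygy.
exists (fun i => syzygy_cover (iter i syzygy A)); do 2 eexists; split.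
  apply: (splice_resolution (incl := syzygy_incl) (aug := syzygy_map)).
  - exact: syzygy_cover_projective.
  - exact: syzygy_incl_plot_kernel.
  - exact: syzygy_map_plot_split.
move=> i im; apply/compactly_free_compactly_generated.
apply/syzygy_cover_compactly_free/rZ.
by rewrite addn1; exact: rA.
Qed.

Lemma type_KP_predP (n : option nat) (A : kMod) :
  type_KP_pred n A <-> forall m, le_ext m n -> cg_resolved m A.
Proof.
split.
  case: n => [[|n]|] /= rA [|m] // mn.
    by apply: (type_KP_cg_resolved (n := Some n)).
  exact: (type_KP_cg_resolved (n := None)).
case: n => [[|n]|] //= rA; apply: type_KP_of_cg_resolved => m mn; exact: rA.
Qed.

Lemma type_KPP (n : option nat) (A : kMod) :
  type_KP n A <-> forall m, le_ext m n -> cg_resolved m.+1 A.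
Proof.
split; last exact: type_KP_of_cg_resolved.
by move=> rA m mn; exact: type_KP_cg_resolved mn rA.
Qed.

End Resolutions.

(** * Types KP_n along short exact sequences *)

Theorem proposition3p9 (G : topGroupType)
    (G_lc : locally_compact [set: G]) (G_td : totally_disconnected [set: G])
    (R : comPzRingType) (n : option nat)
    (A' A A'' : kModType R G) (f : A' -> A) (g : A -> A'')
    (fg_exact : short_exact f g) :
  [/\ type_KP_pred n A' -> type_KP n A -> type_KP n A'',
      type_KP_pred n A -> type_KP n A'' -> type_KP_pred n A'
    & type_KP n A' -> type_KP n A'' -> type_KP n A].
Proof.
have [kerf /ch_splitP splitg] := fg_exact.
have /is_kernelP kerf' := kerf.
have {kerf'}kerf := kerf' splitg.1.
split.
- move=> /type_KP_predP rA' /type_KPP rA; apply/type_KPP => m mn.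
  exact: cg_resolved_quotient kerf splitg (rA' m mn) (rA m mn).
- move=> /type_KP_predP rA /type_KPP rA''; apply/type_KP_predP => m mn.
  exact: cg_resolved_kernel kerf splitg (rA m mn) (rA'' m mn).
- move=> /type_KPP rA' /type_KPP rA''; apply/type_KPP => m mn.
  exact: (cg_resolved_extension kerf splitg (rA' m mn) (rA'' m mn)).
Qed.
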